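(* For a non-negative integer $n$, let $c(n)$ denote the number of (ordinary) partitions of $n$ all of whose parts are congruent to $1$ or $5$ modulo $6$, or congruent to $0$ modulo $4$. Let $\mathcal{D}=\{a,b,c,d,e,f,g,h\}$ be a set of eight colours, and let $d(n)$ denote the number of coloured partitions $(\pi_0,\dots,\pi_s)$ of $n$ with colour set $\mathcal{D}$ (where $\pi_m = (k_m)_{c_m}$ has value $k_m\in\mathbb{Z}_{>0}$ and colour $c_m\in\mathcal{D}$, $k_0\ge k_1\ge\cdots\ge k_s$, and $k_0+\cdots+k_s=n$; for $n=0$ the empty partition is counted) satisfying the following conditions. 1. Difference conditions: let $M$ be the matrix with rows and columns indexed by $\mathcal{D}$ given by $$ \begin{array}{c|cccccccc} & a & b & c & d & e & f & g & h \\ \hline a & 8 & 5 & 6 & 3 & 4 & 5 & 6 & 7 \\ b & 7 & 8 & 5 & 6 & 7 & 4 & 5 & 6 \\ c & 6 & 7 & 8 & 5 & 6 & 7 & 4 & 5 \\ d & 5 & 6 & 7 & 4 & 5 & 6 & 3 & 4 \\ e & 4 & 5 & 6 & 7 & 8 & 5 & 6 & 3 \\ f & 3 & 4 & 5 & 6 & 7 & 8 & 5 & 2 \\ g & 2 & 3 & 4 & 5 & 6 & 7 & 8 & 1 \\ h & 1 & 2 & 3 & 4 & 5 & 6 & 7 & 0 \end{array} $$ where the row label is on the left and the column label on top. Whenever a part $k_j$ (value $k$, colour $j$) is immediately followed in the partition by a part $l_i$ (value $l$, colour $i$), we require $k-l\ge M(i,j)$, where $M(i,j)$ is the entry in row $i$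 and column $j$. 2. Congruence conditions: parts with colour $d$ or $h$ are congruent to $0$ modulo $4$; parts with colour $a$ or $e$ are congruent to $1$ modulo $4$; parts with colour $b$ or $f$ are congruent to $2$ modulo $4$; parts with colour $c$ or $g$ are congruent to $3$ modulo $4$. 3. Initial conditions: the parts $1_e$, $2_f$ and $3_g$ do not occur. Then $c(n)=d(n)$ for all non-negative integers $n$.
   Context: A coloured integer with colour set $\mathcal{D}$ is a symbol $k_x$ with $k\in\mathbb{Z}$ and $x\in\mathcal{D}$; its value is $k$ and its colour is $x$. A coloured partition of $n$ is a finite sequence of coloured integers with positive values, weakly decreasing in value, whose values sum to $n$. *)

(* Defs.v *)
From HB Require Import structures.
From mathcomp Require Import all_boot.

Set Implicit Arguments.
Unset Strict Implicit.
Unset Printing Implicit Defensive.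

Definition is_partition (n : nat) (s : seq nat) : bool :=
  [&& sorted geq s, all (fun k => 0 < k) s & sumn s == n].

Lemma partition_bounds n s :
  is_partition n s -> (size s <= n) && all (fun k => k < n.+1) s.
Proof.
case/and3P=> _ pos_s /eqP <-; elim: s pos_s => //= k s IHs /andP[k_gt0 /IHs].
case/andP=> le_s lt_s; rewrite -add1n leq_add //= ltnS leq_addr /=.
by apply: sub_all lt_s => l; rewrite !ltnS => /leq_trans-> //; apply: leq_addl.
Qed.

Definition c_part (k : nat) : bool :=
  [|| k == 1 %[mod 6], k == 5 %[mod 6] | k == 0 %[mod 4]].

Definition is_c_partition (n : nat) (s : seq nat) : bool :=
  is_partition n s && all c_part s.

(* A partition of n has at most n parts, each at most n, so that all of them
   can be found among the finitely many elements of n.-bseq 'I_n.+1. *)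
Definition c (n : nat) : nat :=
  #|[set p : n.-bseq 'I_n.+1 | is_c_partition n [seq val k | k <- p]]|.

Lemma c_bseq n s : is_c_partition n s ->
  exists p : n.-bseq 'I_n.+1, [seq val k | k <- p] = s.
Proof.
case/andP=> /partition_bounds/andP[size_s lt_s] _.
have size_t : size [seq inord k : 'I_n.+1 | k <- s] <= n by rewrite size_map.
exists (Bseq size_t); rewrite /= -map_comp -[RHS]map_id; apply/eq_in_map => k.
by move/(allP lt_s) => /= /inordK.
Qed.

Inductive colour := Ca | Cb | Cc | Cd | Ce | Cf | Cg | Ch.

Definition colour_index (x : colour) : nat :=
  match x with
  | Ca => 0 | Cb => 1 | Cc => 2 | Cd => 3
  | Ce => 4 | Cf => 5 | Cg => 6 | Ch => 7
  end.

Definition colours : seq colour := [:: Ca; Cb; Cc; Cd; Ce; Cf; Cg; Ch].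

Lemma colour_indexK : cancel colour_index (nth Ca colours).
Proof. by case. Qed.

HB.instance Definition _ := Countable.copy colour (can_type colour_indexK).

Lemma colours_enumP : Finite.axiom colours.
Proof. by case. Qed.

HB.instance Definition _ := isFinite.Build colour colours_enumP.

Definition M (i j : colour) : nat :=
  nth 0 (nth [::]
    [:: (*         a  b  c  d  e  f  g  h *)
        (* a *) [:: 8; 5; 6; 3; 4; 5; 6; 7];
        (* b *) [:: 7; 8; 5; 6; 7; 4; 5; 6];
        (* c *) [:: 6; 7; 8; 5; 6; 7; 4; 5];
        (* d *) [:: 5; 6; 7; 4; 5; 6; 3; 4];
        (* e *) [:: 4; 5; 6; 7; 8; 5; 6; 3];
        (* f *) [:: 3; 4; 5; 6; 7; 8; 5; 2];
        (* g *) [:: 2; 3; 4; 5; 6; 7; 8; 1];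
        (* h *) [:: 1; 2; 3; 4; 5; 6; 7; 0]]
    (colour_index i)) (colour_index j).

(* The part (k, x) stands for k_x. *)
Definition is_coloured_partition (n : nat) (s : seq (nat * colour)) : bool :=
  is_partition n (unzip1 s).

(* The part p is immediately followed by q.  The row of M is the colour of the
   smaller part q.  The inequality is k - l >= M(i, j), written without the
   truncated subtraction of nat. *)
Definition difference_cond (p q : nat * colour) : bool :=
  q.1 + M q.2 p.2 <= p.1.

Definition congruence_cond (p : nat * colour) : bool :=
  match p.2 with
  | Cd | Ch => p.1 == 0 %[mod 4]
  | Ca | Ce => p.1 == 1 %[mod 4]
  | Cb | Cf => p.1 == 2 %[mod 4]
  | Cc | Cg => p.1 == 3 %[mod 4]
  end.

Definition initial_cond (s : seq (nat * colour)) : bool :=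
  [&& (1, Ce) \notin s, (2, Cf) \notin s & (3, Cg) \notin s].

Definition is_d_partition (n : nat) (s : seq (nat * colour)) : bool :=
  [&& is_coloured_partition n s,
      sorted difference_cond s,
      all congruence_cond s
    & initial_cond s].

Definition d (n : nat) : nat :=
  #|[set p : n.-bseq ('I_n.+1 * colour)%type
       | is_d_partition n [seq (val q.1, q.2) | q <- p]]|.

Lemma d_bseq n s : is_d_partition n s ->
  exists p : n.-bseq ('I_n.+1 * colour)%type,
    [seq (val q.1, q.2) | q <- p] = s.
Proof.
case/and4P=> /partition_bounds/andP[size_s lt_s] _ _ _.
have size_t : size [seq (inord q.1 : 'I_n.+1, q.2) | q <- s] <= n.
  by move: size_s; rewrite !size_map.
exists (Bseq size_t); rewrite /= -map_comp -[RHS]map_id; apply/eq_in_map.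
move=> [k x] s_kx /=; rewrite inordK //.
by apply: (allP lt_s); apply: (map_f fst s_kx).
Qed.

(* Main.v *)
Require Import Defs.
From mathcomp Require Import all_boot all_order all_algebra.
From mathcomp Require Import zify ring.

(** Let a coloured partition be followed by infinitely many parts 0_h.  Recording
    by how much each difference exceeds its minimum splits off a partition into
    multiples of 4; what remains is a word in the colours, all differences being
    equal to the entries of M.  As M(i, j) = 4 H(i, j) + ht i - ht j, words are
    counted by a weight in the root lattice of A2 and an energy built from H (the
    level 1 path model of D_4^(3)), and it remains to show that their generating
    function P at the principal grading is 1 / ((q; q^6) (q^5; q^6)).

    The recursion that adds a letter on top of a word is compatible with the three
    simple reflections of the affine Weyl group, so P = C(Q) * sum_mu e^mu Q^|mu|^2,
    with Q = q^4 and mu running through A2.  Summing the words with the sign of the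
    dot action at level 1, the contribution of each last letter other than h is
    antisymmetric and vanishes, so only the empty word survives.  Hence
    C(Q) * S(Q) = 1 for an explicit signed theta series S of A2, which a change of
    lattice coordinates turns into a product of two pentagonal number series,
    S = (Q; Q) (Q^3; Q^3).  At the principal grading the theta series of A2 is half
    the product of two one-dimensional theta series, and the Jacobi triple product
    finishes the proof. *)

Set Implicit Arguments.
Unset Strict Implicit.
Unset Printing Implicit Defensive.
Import Order.TTheory GRing.Theory Num.Theory.

(** * Coloured partitions as towers over the ground part *)

Lemma card_list (T : finType) (S : eqType) (f : T -> S) (P : pred S) (L : seq S) :
  injective f -> uniq L -> L =i P -> (forall s, P s -> exists p, f p = s) ->
  #|[set p | P (f p)]| = size L.
Proof.
move=> inj_f uL memL ex_f; rewrite cardE -(size_map f); apply: perm_size.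
apply: uniq_perm => //; first by rewrite map_inj_uniq ?enum_uniq.
move=> s; rewrite memL; apply/mapP/idP => [[p]|Ps].
  by rewrite mem_enum inE => Pp ->.
by have [p fp] := ex_f s Ps; exists p; rewrite // mem_enum inE fp.
Qed.

(* Partitions are read from the smallest part upwards. *)
Definition above (p q : nat * colour) : bool := difference_cond q p.

Definition next_parts (b : nat * colour) (n : nat) : seq (nat * colour) :=
  [seq p <- [seq (k, x) | k <- iota 0 n.+1, x <- colours]
       | above b p && congruence_cond p].

(** The length [N] is exact. As [0_h] may rest on [0_h], shorter partitions are padded with ground
    parts, which is why [next_parts] allows the value 0. *)
Fixpoint towers (N : nat) (b : nat * colour) (n : nat) : seq (seq (nat * colour)) :=
  if N is N'.+1 then
    flatten [seq [seq p :: r | r <- towers N' p (n - p.1)] | p <- next_parts b n]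
  else if n == 0 then [:: [::]] else [::].

Lemma mem_next_parts b n p :
  (p \in next_parts b n) = [&& p.1 <= n, above b p & congruence_cond p].
Proof.
rewrite mem_filter andbC; congr (_ && _).
apply/allpairsP/idP => [[[k x] [+ _ ->]]|le_pn]; first by rewrite mem_iota.
by exists p; rewrite mem_iota; split=> //; case: p {le_pn} => k [].
Qed.

Lemma next_parts_uniq b n : uniq (next_parts b n).
Proof.
by rewrite filter_uniq // allpairs_uniq ?iota_uniq // => -[? ?] [? ?].
Qed.

Lemma mem_towers N b n r :
  (r \in towers N b n) =
  [&& size r == N, path above b r, all congruence_cond r & sumn (unzip1 r) == n].
Proof.
elim: N b n r => [|N IH] b n r.
  by case: n r => [|n] [|p r].
apply/flatten_mapP/idP => [[p]|].
  rewrite mem_next_parts => /and3P[le_pn bp cp] /mapP[r' + ->].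
  rewrite IH => /and4P[/eqP sz pr cr /eqP sr] /=.
  by rewrite sz bp pr cp cr sr subnKC ?eqxx.
case: r => [|p r] //= /and4P[sz /andP[bp pr] /andP[cp cr] /eqP sm].
exists p; first by rewrite mem_next_parts bp cp -sm leq_addr.
by apply/mapP; exists r => //; rewrite IH -eqSS sz pr cr -sm addKn /=.
Qed.

Lemma towers_uniq N b n : uniq (towers N b n).
Proof.
elim: N b n => [|N IH] b n /=; first by case: eqP.
elim: (next_parts b n) (next_parts_uniq b n) => //= p s IHs /andP[ps us].
rewrite cat_uniq map_inj_uniq ?IH ?IHs //=; last by move=> r r' [].
rewrite andbT; apply/hasPn => r /flatten_mapP[q qs /mapP[r' _ ->]].
apply/negP => /mapP[r'' _ [eq_qp _]]; by rewrite -eq_qp qs in ps.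
Qed.

Lemma size_towersS N b n :
  size (towers N.+1 b n) = \sum_(p <- next_parts b n) size (towers N p (n - p.1)).
Proof.
rewrite size_flatten /shape -map_comp sumnE big_map.
by apply: eq_bigr => p _; rewrite /= size_map.
Qed.

Lemma towers_small N b n : n < N * b.1 -> size (towers N b n) = 0.
Proof.
elim: N b n => [|N IH] b n lt_n //; rewrite size_towersS big1_seq // => p.
rewrite mem_next_parts /above /difference_cond => /andP[_ /and3P[le_pn le_bp _]].
apply: IH; rewrite ltn_subLR // -mulSn; apply: leq_trans lt_n _.
by rewrite leq_mul2l (leq_trans (leq_addr _ _) le_bp).
Qed.

(** By the congruences, the lowest part exceeds its minimum [l + M i j] by a multiple of 4: either
    by 0, or by at least 4, and then the base can be raised to [l + 4]. *)
Lemma size_towers_split N l i n : congruence_cond (l, i) ->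
  size (towers N.+1 (l, i) n) =
    \sum_(j <- colours | l + M i j <= n)
       size (towers N (l + M i j, j) (n - (l + M i j)))
    + size (towers N.+1 (l + 4, i) n).
Proof.
move=> cli; rewrite !size_towersS.
rewrite -[X in _ = X + _]big_filter.
rewrite -(big_map (fun j => (l + M i j, j)) xpredT
            (fun p => size (towers N p (n - p.1)))) -big_cat.
apply: perm_big; apply: uniq_perm; first exact: next_parts_uniq.
  rewrite cat_uniq next_parts_uniq map_inj_uniq ?filter_uniq // => [|? ? []] //.
  rewrite andbT; apply/hasPn => -[k j]; rewrite mem_next_parts => /and3P[_ lt_k _].
  apply/negP => /mapP[j' _ [ek ej]]; move: lt_k.
  by rewrite /above /difference_cond /= ek ej; lia.
move=> [k j]; rewrite mem_cat !mem_next_parts /=.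
have -> : ((k, j) \in [seq (l + M i j, j) | j <- [seq j <- colours | l + M i j <= n]])
    = (k == l + M i j) && (k <= n).
  apply/mapP/idP => [[j']|/andP[/eqP ek le_kn]].
    by rewrite mem_filter => /andP[le_n _] [-> ->]; rewrite eqxx.
  by exists j; rewrite -?ek // mem_filter -ek le_kn; case: j {ek}.
rewrite /above /difference_cond /= /congruence_cond /= in cli *.
by case: i cli => /=; case: j => /=; rewrite /M /=; lia.
Qed.

(** Here [n] is the sum in excess of [N.+1] parts at level [l]. A step by [M i j] raises the level
    of all of them, whence the factor [N.+1]. *)
Lemma towersS_rel N l i n : congruence_cond (l, i) ->
  size (towers N.+1 (l, i) (N.+1 * l + n)) =
    \sum_(j <- colours | N.+1 * M i j <= n)
       size (towers N (l + M i j, j) (N * (l + M i j) + (n - N.+1 * M i j)))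
    + (if 4 * N.+1 <= n
       then size (towers N.+1 (l + 4, i) (N.+1 * (l + 4) + (n - 4 * N.+1)))
       else 0).
Proof.
move=> cli; rewrite size_towers_split //; congr (_ + _).
  rewrite [LHS]big_mkcond [RHS]big_mkcond; apply: eq_bigr => j _.
  move: (M i j) => m; case: (leqP (N.+1 * m) n) => [le_mn|lt_nm].
    rewrite ifT; last by lia.
    by congr (size (towers _ _ _)); lia.
  by case: ifP => // le_l; apply: towers_small => /=; lia.
case: ifP => [le_n|/negbT lt_n].
  by have -> : N.+1 * l + n = N.+1 * (l + 4) + (n - 4 * N.+1) by lia.
by apply: towers_small => /=; lia.
Qed.

Lemma congruence_condD l i j :
  congruence_cond (l, i) -> congruence_cond (l + M i j, j).
Proof. by rewrite /congruence_cond; case: i; case: j; rewrite /M /=; lia. Qed.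

Lemma congruence_condD4 l i : congruence_cond (l, i) -> congruence_cond (l + 4, i).
Proof. by rewrite /congruence_cond; case: i => /=; lia. Qed.

(** The relative recursion does not involve [l], so only the colour of the base matters. The inner
    induction on [n] serves the branch that raises the base by 4. *)
Lemma towers_shift N l l' i n :
  congruence_cond (l, i) -> congruence_cond (l', i) ->
  size (towers N (l, i) (N * l + n)) = size (towers N (l', i) (N * l' + n)).
Proof.
elim: N l l' i n => [|N IH] l l' i n; first by rewrite !mul0n.
elim/ltn_ind: n l l' => n IHn l l' cl cl'; rewrite [LHS]towersS_rel // [RHS]towersS_rel //.
congr (_ + _).
  by apply: eq_bigr => j _; apply: IH; apply: congruence_condD.
by case: ifP => // le_n; apply: IHn; rewrite ?congruence_condD4 //; lia.
Qed.

Definition residue (i : colour) : nat :=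
  match i with Ca | Ce => 1 | Cb | Cf => 2 | Cc | Cg => 3 | Cd | Ch => 0 end.

Lemma residueP i : congruence_cond (residue i, i).
Proof. by case: i. Qed.

Definition tower_count (N : nat) (i : colour) (n : nat) : nat :=
  size (towers N (residue i, i) (N * residue i + n)).

Lemma tower_countS N i n : tower_count N.+1 i n =
  \sum_(j <- colours | N.+1 * M i j <= n) tower_count N j (n - N.+1 * M i j)
  + (if 4 * N.+1 <= n then tower_count N.+1 i (n - 4 * N.+1) else 0).
Proof.
rewrite {1}/tower_count towersS_rel ?residueP //; congr (_ + _).
  by apply: eq_bigr => j _; apply: towers_shift; first apply: congruence_condD;
    exact: residueP.
by case: ifP => // _; apply: towers_shift; first apply: congruence_condD4;
  exact: residueP.
Qed.

Definition pos_part (p : nat * colour) : bool := 0 < p.1.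
Definition ground : nat * colour := (0, Ch).

Lemma path_pos b r : 0 < b.1 -> path above b r -> all pos_part r.
Proof.
elim: r b => //= p r IH b b0 /andP[bp pr].
have p0 : 0 < p.1 by apply: leq_trans b0 (leq_trans (leq_addr _ _) bp).
by rewrite {1}/pos_part p0 (IH p).
Qed.

Lemma tower_decomp r : path above ground r ->
  r = nseq (size r - size (filter pos_part r)) ground ++ filter pos_part r.
Proof.
elim: r => //= p r IH /andP[bp pr]; case: ifP => [p0|/negbT np].
  by rewrite (all_filterP (path_pos p0 pr)) subnn.
have eqp : p = ground.
  move: bp np; rewrite /above /difference_cond /pos_part; case: p {pr} => k x /=.
  by case: k => //; case: x.
rewrite eqp in pr *; rewrite subSn ?size_filter ?count_size //= -size_filter.
by rewrite -IH.
Qed.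

Definition not_initial (p : nat * colour) : bool :=
  p \notin [:: (1, Ce); (2, Cf); (3, Cg)].

Lemma path_not_initial b r : (b == ground) || (0 < b.1) ->
  path above b r -> all pos_part r -> all not_initial r.
Proof.
elim: r b => //= p r IH b bP /andP[bp pr] /andP[p0 pos_r].
have -> : all not_initial r by apply: (IH p) => //; apply/orP; right.
rewrite andbT.
rewrite /not_initial !inE; apply/negP => /or3P[]/eqP ep;
  move: bp; rewrite ep /above /difference_cond /= => {ep};
  case/orP: bP => [/eqP-> //|]; case: b => l y /=; case: y; rewrite /M /=; lia.
Qed.

(** Row [h] of [M] demands at most the least positive value of the right residue, except for [e],
    [f], [g], where it demands 5, 6, 7: this is what the initial conditions encode. *)
Lemma above_ground p : pos_part p -> congruence_cond p -> not_initial p ->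
  above ground p.
Proof.
case: p => k x; rewrite /above /difference_cond /pos_part /congruence_cond /=.
move=> k0 cp /negP ni; move: cp.
have kP y : y \in [:: (1, Ce); (2, Cf); (3, Cg)] -> (k, x) != y.
  by move=> iny; apply/eqP => e; apply: ni; rewrite e.
case: x {ni} kP; rewrite /M /= => kP cp; try lia.
- suff: k != 1 by lia.
  by apply: contraNneq (kP (1, Ce) isT) => ->.
- suff: k != 2 by lia.
  by apply: contraNneq (kP (2, Cf) isT) => ->.
suff: k != 3 by lia.
by apply: contraNneq (kP (3, Cg) isT) => ->.
Qed.

Lemma initial_condE s : initial_cond s = all not_initial s.
Proof.
apply/and3P/allP => [[n1 n2 n3] p s_p|ni].
  by rewrite /not_initial !inE; apply/negP => /or3P[]/eqP ep;
    rewrite ep ?(negPf n1) ?(negPf n2) ?(negPf n3) in s_p.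
by split; apply/negP => /ni.
Qed.

Lemma last_ground k : last ground (nseq k ground) = ground.
Proof. by elim: k. Qed.

(** Padding with copies of [0_h] inverts [strip]; there is room for it, as a partition of [n] has at
    most [n] parts. *)
Lemma d_towers N n : n <= N -> d n = size (towers N ground n).
Proof.
move=> le_nN.
pose strip (r : seq (nat * colour)) := rev (filter pos_part r).
rewrite -(size_map strip); apply: card_list.
- by move=> p q /inj_map eq_pq; apply/val_inj/eq_pq => -[? ?] [? ?] [/val_inj-> ->].
- rewrite map_inj_in_uniq ?towers_uniq // => r r'.
  rewrite !mem_towers => /and4P[/eqP sz pr _ _] /and4P[/eqP sz' pr' _ _].
  move=> /(can_inj revK) eqf.
  by rewrite (tower_decomp pr) (tower_decomp pr') sz sz' eqf.
- move=> s; apply/mapP/idP => [[r]|].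
    rewrite mem_towers => /and4P[_ pr cr /eqP sr] ->; rewrite /strip.
    set f := filter pos_part r.
    have pf : path above ground f.
      have := pr; rewrite {1}(tower_decomp pr) cat_path -/f => /andP[_].
      by rewrite last_ground.
    have posf : all pos_part f by apply: filter_all.
    have sf : sumn (unzip1 f) = n.
      rewrite -sr (tower_decomp pr) -/f /unzip1 map_cat sumn_cat.
      by rewrite map_nseq sumn_nseq mul0n.
    have sortf : sorted difference_cond (rev f).
      by rewrite rev_sorted; apply: path_sorted pf.
    apply/and4P; split=> //.
    - apply/and3P; split.
      + rewrite sorted_map; apply: sub_sorted sortf => p q.
        by rewrite /difference_cond; apply: leq_trans (leq_addr _ _).
      + by rewrite all_map all_rev.
      + by rewrite /unzip1 map_rev sumn_rev sf.
    - by rewrite all_rev all_filter; apply: sub_all cr => p /= cp; apply/implyP.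
    - by rewrite initial_condE all_rev (path_not_initial _ pf).
  case/and4P=> ps sorts cs; rewrite initial_condE => ini.
  have [/andP[size_s _]] := (partition_bounds ps, ps).
  move=> /and3P[_ pos_s /eqP sum_s].
  rewrite size_map in size_s; rewrite all_map in pos_s.
  exists (nseq (N - size s) ground ++ rev s); last first.
    rewrite /strip filter_cat (_ : filter _ (nseq _ _) = [::]) /=.
      by rewrite (all_filterP _) ?revK // all_rev.
    by elim: (N - size s).
  rewrite mem_towers size_cat size_nseq size_rev subnK ?eqxx;
    last exact: leq_trans size_s le_nN.
  rewrite all_cat all_rev cs all_nseq orbT /unzip1 map_cat map_nseq sumn_cat.
  rewrite sumn_nseq mul0n map_rev sumn_rev sum_s eqxx !andbT andTb cat_path.
  apply/andP; split; first by elim: (N - size s) => //= k ->.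
  rewrite last_ground.
  move: sorts; rewrite -{1}[s]revK rev_sorted.
  have: all (fun p => above ground p) (rev s).
    rewrite all_rev; apply/allP => p s_p.
    by apply: above_ground; [exact: (allP pos_s)|exact: (allP cs)|exact: (allP ini)].
  by case: (rev s) => //= p t /andP[-> _].
exact: d_bseq.
Qed.

(** * Ordinary partitions *)

(* F is fuel: K + n is enough. *)
Fixpoint parts (F K n : nat) : seq (seq nat) :=
  match F, K with
  | F'.+1, K'.+1 =>
      parts F' K' n ++
      (if c_part K && (K <= n) then [seq K :: s | s <- parts F' K (n - K)] else [::])
  | _, _ => if n == 0 then [:: [::]] else [::]
  end.

Lemma partsS F K n : parts F.+1 K.+1 n = parts F K n ++
  (if c_part K.+1 && (K < n) then [seq K.+1 :: s | s <- parts F K.+1 (n - K.+1)]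
   else [::]).
Proof. by []. Qed.

Lemma mem_parts F K n s : K + n <= F ->
  (s \in parts F K n) =
  [&& sorted geq s, all (fun k => 0 < k <= K) s, all c_part s & sumn s == n].
Proof.
have base n' s' : (s' \in if n' == 0 then [:: [::]] else [::]) =
    [&& sorted geq s', all (fun k => 0 < k <= 0) s', all c_part s' & sumn s' == n'].
  case: s' => [|k s']; first by case: n'.
  have -> : all (fun k => 0 < k <= 0) (k :: s') = false by case: k.
  by rewrite andbF; case: n'.
elim: F K n s => [|F IH] [|K] n s leF; try exact: base; first by [].
rewrite partsS mem_cat IH; last by lia.
have -> : (s \in if c_part K.+1 && (K.+1 <= n) then
      [seq K.+1 :: s0 | s0 <- parts F K.+1 (n - K.+1)] else [::])
    = if s is k :: s' then [&& k == K.+1, c_part K.+1, K.+1 <= n &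
        s' \in parts F K.+1 (n - K.+1)] else false.
  case: ifP => [/andP[cK leK]|nK].
    case: s => [|k s]; first by apply/mapP => -[].
    apply/mapP/idP => [[s' s'_in [-> ->]]|/and4P[/eqP-> _ _ s_in]].
      by rewrite eqxx cK leK.
    by exists s.
  by case: s => // k s; case: eqP => //= _; rewrite andbA nK.
case: s => [|k s]; first by rewrite orbF.
have -> : (K < n) && (s \in parts F K.+1 (n - K.+1)) = [&& K < n, sorted geq s,
    all (fun k => 0 < k <= K.+1) s, all c_part s & sumn s == n - K.+1].
  by case: ltnP => //= lt_Kn; rewrite IH //; lia.
have geq_trans : transitive geq by move=> x y z /=; lia.
rewrite /= path_sortedE //; case: (ltngtP k K.+1) => [lt_k|gt_k|eq_k] /=.
- rewrite orbF; case: (boolP (all _ s)) => //= ps; congr (_ && _).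
  have -> : (k <= K) = true by lia.
  congr (_ && _); congr (_ && _).
  by apply: eq_in_all => x /(allP ps) /=; lia.
- have -> : (k <= K) = false by lia.
  by rewrite !andbF.
rewrite eq_k [K.+1 <= K](_ : _ = false) ?andbF ?leqnn /=; last by lia.
have -> : (K.+1 + sumn s == n) = (K < n) && (sumn s == n - K.+1) by lia.
case: (boolP (all (fun k => 0 < k <= K.+1) s)) => [le_s|]; last by rewrite !andbF.
have -> : all (geq K.+1) s by apply: sub_all le_s => x /andP[].
by case: (sorted _ _) (c_part _) (K < n) (all _ s) => -[] [] [].
Qed.

(** Unlike [mem_parts], this needs no bound on the fuel; it separates the two branches in
    [parts_uniq]. *)
Lemma parts_le F K n s : s \in parts F K n -> all (leq^~ K) s.
Proof.
have base n' : s \in (if n' == 0 then [:: [::]] else [::]) -> all (leq^~ K) s.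
  by case: ifP => // _; rewrite inE => /eqP->.
elim: F K n s base => [|F IH] [|K] n s base; try exact: base.
rewrite partsS mem_cat => /orP[|].
  move/IH => le_s; apply: sub_all (le_s _) => [k|]; first exact: leqW.
  by move=> n'; case: ifP => // _; rewrite inE => /eqP->.
case: ifP => // _ /mapP[s' s'_in ->]; rewrite /= leqnn /=.
by apply: IH s'_in => n'; case: ifP => // _; rewrite inE => /eqP->.
Qed.

Lemma parts_uniq F K n : uniq (parts F K n).
Proof.
elim: F K n => [|F IH] [|K] n; try by rewrite /=; case: ifP.
rewrite partsS cat_uniq IH /=; apply/andP; split; last first.
  by case: ifP => // _; rewrite map_inj_uniq // => ? ? [].
case: ifP => _ //; apply/hasPn => _ /mapP[s _ ->].
by apply/negP => /parts_le /=; rewrite ltnn.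
Qed.

Definition cpart_count (K n : nat) : nat := size (parts (K + n) K n).

Lemma size_parts F K n : K + n <= F -> size (parts F K n) = cpart_count K n.
Proof.
move=> leF; apply: perm_size; apply: uniq_perm; rewrite ?parts_uniq // => s.
by rewrite !mem_parts.
Qed.

Lemma cpart_count0 n : cpart_count 0 n = (n == 0).
Proof. by rewrite /cpart_count; case: n. Qed.

Lemma cpart_countS K n : cpart_count K.+1 n =
  cpart_count K n + (if c_part K.+1 && (K < n) then cpart_count K.+1 (n - K.+1) else 0).
Proof.
rewrite {1}/cpart_count addSn partsS size_cat size_parts //; congr (_ + _).
case: (boolP (c_part _)) => //= _; case: ltnP => //= lt_Kn.
by rewrite size_map size_parts //; lia.
Qed.

Lemma c_cpart_count K n : n <= K -> c n = cpart_count K n.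
Proof.
move=> le_nK; apply: card_list; first 1 last.
- exact: parts_uniq.
- move=> s; rewrite mem_parts // unfold_in /is_c_partition /is_partition.
  have -> : all (fun k => 0 < k <= K) s = all (fun k => 0 < k) s && all (leq^~ K) s.
    by rewrite -all_predI.
  apply/idP/idP => [/and4P[-> /andP[-> _] -> ->] //|].
  case/andP=> ps ->; have /andP[_ le_s] := partition_bounds ps.
  move: ps => /and3P[-> -> ->]; rewrite /= andbT.
  by apply: sub_all le_s => k; rewrite ltnS => /leq_trans; apply.
- exact: c_bseq.
by move=> p q /(inj_map val_inj) /val_inj.
Qed.

Local Open Scope ring_scope.

(** * Words in the colours and the three reflections *)

(* The matrix H of the decomposition M i j = 4 * H i j + ht i - ht j, see M_energy. *)
Definition energy (i j : colour) : nat :=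
  nth 0%N (nth [::]
    [:: [:: 2; 1; 1; 0; 0; 0; 0; 1];
        [:: 2; 2; 1; 1; 1; 0; 0; 1];
        [:: 2; 2; 2; 1; 1; 1; 0; 1];
        [:: 2; 2; 2; 1; 1; 1; 0; 1];
        [:: 2; 2; 2; 2; 2; 1; 1; 1];
        [:: 2; 2; 2; 2; 2; 2; 1; 1];
        [:: 2; 2; 2; 2; 2; 2; 2; 1];
        [:: 1; 1; 1; 1; 1; 1; 1; 0]]%N (colour_index i)) (colour_index j).

(* Coordinates in the basis b, c of the lattice A2 of short roots of G2: a = b + c, e = - c,
   f = - b, g = - a, while d and h have weight 0. *)
Definition wt1 (x : colour) : int :=
  match x with Ca | Cb => 1 | Cf | Cg => - 1 | _ => 0 end.
Definition wt2 (x : colour) : int :=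
  match x with Ca | Cc => 1 | Ce | Cg => - 1 | _ => 0 end.

(** [N] letters lie over [i]; the step to the lowest one counts [N] times because it lifts all of
    them, as in [towersS_rel]. *)
Fixpoint words (N : nat) (i : colour) (m n k : int) : int :=
  if N is N'.+1 then
    \sum_(j <- colours)
      words N' j (m - wt1 j) (n - wt2 j) (k - (N * energy i j)%N%:Z)
  else ((m == 0) && (n == 0) && (k == 0))%:Z.

Lemma wordsS N i m n k : words N.+1 i m n k =
    words N Ca (m - 1) (n - 1) (k - (N.+1 * energy i Ca)%N%:Z)
  + words N Cb (m - 1) n (k - (N.+1 * energy i Cb)%N%:Z)
  + words N Cc m (n - 1) (k - (N.+1 * energy i Cc)%N%:Z)
  + words N Cd m n (k - (N.+1 * energy i Cd)%N%:Z)
  + words N Ce m (n + 1) (k - (N.+1 * energy i Ce)%N%:Z)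
  + words N Cf (m + 1) n (k - (N.+1 * energy i Cf)%N%:Z)
  + words N Cg (m + 1) (n + 1) (k - (N.+1 * energy i Cg)%N%:Z)
  + words N Ch m n (k - (N.+1 * energy i Ch)%N%:Z).
Proof. by rewrite [LHS]/= !big_cons big_nil /= !subr0 !opprK !addrA. Qed.

Lemma words_cd N m n k : words N Cc m n k = words N Cd m n k.
Proof. by case: N => // N; rewrite !wordsS. Qed.

(** Row [g] of [energy] is row [h] plus 1, and the first step has weight [N]. *)
Lemma words_gh N m n k : words N Cg m n k = words N Ch m n (k - N%:Z).
Proof.
case: N => [|N]; first by rewrite subr0.
rewrite !wordsS /energy /=; do ?congr (_ + _); congr words; lia.
Qed.

(** Identifies values of [words] whose arguments agree by linear arithmetic and abstracts them,
    which leaves a linear goal. *)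
Ltac collect_words :=
  repeat match goal with
  | |- context [words ?N ?j ?x ?y ?z] =>
    let v := fresh "v" in
    repeat match goal with
    | |- context [words N j ?x' ?y' ?z'] =>
      first [constr_eq x x'; constr_eq y y'; constr_eq z z'; fail 1
            | rewrite (_ : words N j x' y' z' = words N j x y z); last (congr words; lia)]
    end;
    move: (words N j x y z) => v
  end.

(* The three records say how the simple reflections act on the words of length N
   over a given letter.  The symmetry is exact for some letters; the defect for
   another one is expressed through the next letter of its crystal string, and
   only these corrected statements are stable under the recursion. *)
Record sym1 (N : nat) : Prop := Sym1 {
  sym1b : forall m n k, words N Cb m (m - n) k = words N Cb m n k;
  sym1e : forall m n k, words N Ce m (m - n) k = words N Ce m n k;
  sym1h : forall m n k, words N Ch m (m - n) k = words N Ch m n k;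
  sym1f : forall m n k, words N Cf m (m - n) k =
            words N Cf m (n - 1) k + words N Cg m n k - words N Cg m (n - 1) k;
  sym1d : forall m n k, words N Cd m (m - n) k =
            words N Cd m (n - 1) k + words N Ce m n k - words N Ce m (n - 1) k;
  sym1a : forall m n k, words N Ca m (m - n) k =
            words N Ca m (n - 1) k + words N Cb m n k - words N Cb m (n - 1) k }.

(** Reflection in the short root [c]: it exchanges the weights of [a] and [b], of [c] and [e], and
    of [f] and [g]. *)
Lemma words_sym1 N : sym1 N.
Proof.
elim: N => [|N [b e h f d a]]; first by split=> m n k /=; lia.
have r x y : x - (x - y) = y :> int by lia.
(* The hypotheses are turned around so as to rewrite the terms of the reflected side, at the
   arguments where [wordsS] produces them. *)
have {}b x y k : words N Cb x y k = words N Cb x (x - y) k by rewrite -b.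
have {}e x y k : words N Ce x y k = words N Ce x (x - y) k by rewrite -e.
have {}h x y k : words N Ch x y k = words N Ch x (x - y) k by rewrite -h.
have g x y k : words N Cg x y k = words N Cg x (x - y) k by rewrite !words_gh h.
have {}f x y k : words N Cf x y k =
  words N Cf x (x - y - 1) k + words N Cg x (x - y) k - words N Cg x (x - y - 1) k.
  by rewrite -f r.
have {}d x y k : words N Cd x y k =
  words N Cd x (x - y - 1) k + words N Ce x (x - y) k - words N Ce x (x - y - 1) k.
  by rewrite -d r.
have {}a x y k : words N Ca x y k =
  words N Ca x (x - y - 1) k + words N Cb x (x - y) k - words N Cb x (x - y - 1) k.
  by rewrite -a r.
split=> m n k; rewrite !wordsS /energy /= !words_cd (a (m - 1) (m - n - 1))
  (b (m - 1) (m - n)) (d m (m - n - 1)) (d m (m - n)) (e m (m - n + 1))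
  (f (m + 1) (m - n)) (g (m + 1) (m - n + 1)) (h m (m - n)).
all: (collect_words; lia).
Qed.

Record sym2 (N : nat) : Prop := Sym2 {
  sym2a : forall m n k, words N Ca n m k = words N Ca m n k;
  sym2d : forall m n k, words N Cd n m k = words N Cd m n k;
  sym2f : forall m n k, words N Cf n m k = words N Cf m n k;
  sym2h : forall m n k, words N Ch n m k = words N Ch m n k;
  sym2b : forall m n k, words N Cb n m k =
            words N Cb (m - 1) (n + 1) k + words N Cd m n k - words N Cd (m - 1) (n + 1) k;
  sym2e : forall m n k, words N Ce n m k =
            words N Ce (m - 1) (n + 1) k + words N Cf m n k - words N Cf (m - 1) (n + 1) k }.

(** Reflection in the long root [b - c]: it exchanges the weights of [b] and [c], and of [e] and
    [f]. *)
Lemma words_sym2 N : sym2 N.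
Proof.
elim: N => [|N [a d f h b e]]; first by split=> m n k /=; lia.
have g x y k : words N Cg x y k = words N Cg y x k by rewrite !words_gh h.
split=> m n k; rewrite !wordsS /energy /= !words_cd (a (m - 1) (n - 1))
  (b m (n - 1)) (d (m - 1) n) (d m n) (e (m + 1) n)
  (f m (n + 1)) (g (n + 1) (m + 1)) (h m n).
all: (collect_words; lia).
Qed.

Record sym0 (N : nat) : Prop := Sym0 {
  sym0a : forall m n k, words N Ca (- n) (- m) (k - m - n) = words N Ca m n k;
  sym0b : forall m n k, words N Cb (- n) (- m) (k - m - n) = words N Cb m n k;
  sym0d : forall m n k, words N Cd (- n) (- m) (k - m - n) = words N Cd m n k;
  sym0h : forall m n k, words N Ch (- n) (- m) (k - m - n) =
            words N Ch (m + 1) (n + 1) (k + 1) + words N Ca m n (k - N%:Z)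
            - words N Ca (m + 1) (n + 1) (k + 1 - N%:Z);
  sym0e : forall m n k, words N Ce (- n) (- m) (k - m - n) =
            words N Ce (m + 1) (n + 1) (k + 1) + words N Cb m n (k - N%:Z)
            - words N Cb (m + 1) (n + 1) (k + 1 - N%:Z);
  sym0f : forall m n k, words N Cf (- n) (- m) (k - m - n) =
            words N Cf (m + 1) (n + 1) (k + 1) + words N Cd m n (k - N%:Z)
            - words N Cd (m + 1) (n + 1) (k + 1 - N%:Z) }.

(** The affine reflection: its linear part is the reflection in [a], and the energy moves by
    [m + n]. *)
Lemma words_sym0 N : sym0 N.
Proof.
elim: N => [|N [a b d h e f]]; first by split=> m n k /=; lia.
have {}a x y k : words N Ca x y k = words N Ca (- y) (- x) (k - x - y).
  by rewrite -a; congr words; lia.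
have {}b x y k : words N Cb x y k = words N Cb (- y) (- x) (k - x - y).
  by rewrite -b; congr words; lia.
have {}d x y k : words N Cd x y k = words N Cd (- y) (- x) (k - x - y).
  by rewrite -d; congr words; lia.
have {}h x y k : words N Ch x y k = words N Ch (- y + 1) (- x + 1) (k - x - y + 1)
    + words N Ca (- y) (- x) (k - x - y - N%:Z)
    - words N Ca (- y + 1) (- x + 1) (k - x - y + 1 - N%:Z).
  by rewrite -h; congr words; lia.
have {}e x y k : words N Ce x y k = words N Ce (- y + 1) (- x + 1) (k - x - y + 1)
    + words N Cb (- y) (- x) (k - x - y - N%:Z)
    - words N Cb (- y + 1) (- x + 1) (k - x - y + 1 - N%:Z).
  by rewrite -e; congr words; lia.
have {}f x y k : words N Cf x y k = words N Cf (- y + 1) (- x + 1) (k - x - y + 1)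
    + words N Cd (- y) (- x) (k - x - y - N%:Z)
    - words N Cd (- y + 1) (- x + 1) (k - x - y + 1 - N%:Z).
  by rewrite -f; congr words; lia.
split=> m n k; rewrite !wordsS /energy /= !words_cd (a (- n - 1) (- m - 1))
  (b (- n - 1) (- m)) (d (- n) (- m - 1)) (d (- n) (- m)) (e (- n) (- m + 1))
  (f (- n + 1) (- m)) !words_gh (h (- n + 1) (- m + 1)) (h (- n) (- m)).
all: (collect_words; lia).
Qed.

(** * String functions *)

(** The summands are grouped for [phi_words], where each group but the last is killed by one dot
    reflection; [c] is traded for [d] by [words_cd]. *)
Lemma words_hS N m n k : words N.+1 Ch m n k =
    words N Ca (m - 1) (n - 1) (k - N.+1%:Z) + words N Cb (m - 1) n (k - N.+1%:Z)
  + words N Cd m (n - 1) (k - N.+1%:Z)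
  + (words N Cd m n (k - N.+1%:Z) + words N Ce m (n + 1) (k - N.+1%:Z))
  + words N Cf (m + 1) n (k - N.+1%:Z) + words N Cg (m + 1) (n + 1) (k - N.+1%:Z)
  + words N Ch m n k.
Proof. by rewrite wordsS /energy /= !muln1 muln0 subr0 words_cd; lia. Qed.

Lemma words_ge0 N i m n k : 0 <= words N i m n k.
Proof.
elim: N i m n k => [|N IH] i m n k; first by rewrite /=; lia.
by rewrite /= sumr_ge0.
Qed.

Lemma words_neg N i m n k : k < 0 -> words N i m n k = 0.
Proof.
elim: N i m n k => [|N IH] i m n k lt_k0; first by rewrite /=; lia.
by rewrite /= big1 // => j _; apply: IH; lia.
Qed.

Lemma words_supp N i m n k : words N i m n k != 0 -> (`|m| <= N)%N && (`|n| <= N)%N.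
Proof.
elim: N i m n k => [|N IH] i m n k; first by rewrite /=; lia.
apply: contraR => out_mn; rewrite /= big1 // => j _; apply/eqP.
apply: contraR out_mn => /IH; case: j => /=; lia.
Qed.

Lemma words_mono N N' m n k : (N <= N')%N -> words N Ch m n k <= words N' Ch m n k.
Proof.
move/subnK <-; elim: (_ - N)%N => // p /le_trans; apply.
by rewrite addSn words_hS lerDr !addr_ge0 ?words_ge0.
Qed.

(** Over [h], any letter other than [h] costs an energy equal to the length of the word. *)
Lemma words_stable N N' m n k : (N <= N')%N -> k <= N%:Z ->
  words N' Ch m n k = words N Ch m n k.
Proof.
move/subnK <- => le_kN; elim: (_ - N)%N => // p IH.
have V0 i m' n' : words (p + N) i m' n' (k - (p + N).+1%:Z) = 0.
  by apply: words_neg; lia.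
by rewrite addSn words_hS !V0 !add0r.
Qed.

(* The number of words of weight (m, n) and energy k over an infinite tail
   of the letter h. *)
Definition wlim (m n k : int) : int := words `|k| Ch m n k.

Lemma words_wlim N m n k : k <= N%:Z -> words N Ch m n k = wlim m n k.
Proof.
move=> le_kN; case: (ltrP k 0) => [k0|k0]; first by rewrite /wlim !words_neg.
by apply: words_stable; lia.
Qed.

Lemma wlim_s1 m n k : wlim m (m - n) k = wlim m n k.
Proof. exact: (sym1h (words_sym1 _)). Qed.

Lemma wlim_s2 m n k : wlim n m k = wlim m n k.
Proof. exact: (sym2h (words_sym2 _)). Qed.

Lemma wlim_s0 m n k : wlim (- n) (- m) (k - m - n) = wlim (m + 1) (n + 1) (k + 1).
Proof.
(* With [N] this large the two defect terms of [sym0h] have negative energy, so the symmetry becomes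
   exact. *)
pose N := (`|k| + `|m| + `|n| + 2)%N.
rewrite -!(@words_wlim N) ?/N; try lia.
by rewrite (sym0h (words_sym0 _)) !(@words_neg _ Ca) ?addr0 ?subr0 //; lia.
Qed.

Lemma wlim_rot m n k : wlim (m - n) m k = wlim m n k.
Proof. by rewrite wlim_s2 wlim_s1. Qed.

Lemma wlim_opp m n k : wlim (- n) (- m) k = wlim m n k.
Proof.
rewrite -(wlim_rot m n) -(wlim_s1 (m - n)) -(wlim_s2 (m - n)) -wlim_s1.
by congr wlim; lia.
Qed.

(** The affine reflection times its linear part is the translation by the weight of [a]; conjugating
    by [wlim_rot] then gives the translation by that of [c]. *)
Lemma wlim_trans m n k : wlim (m + 1) (n + 1) (k + m + n + 1) = wlim m n k.
Proof. by rewrite -wlim_s0 -[RHS]wlim_opp; congr wlim; lia. Qed.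

Lemma wlim_trans2 m n k : wlim m (n + 1) (k + 2 * n - m + 1) = wlim m n k.
Proof.
have <- : wlim (n - (n - m)) n k = wlim m n k by congr wlim; lia.
by rewrite wlim_rot -(wlim_trans n) -[RHS]wlim_rot; congr wlim; lia.
Qed.

Definition qA2 (m n : int) : int := m * m - m * n + n * n.

Lemma wlimE m n k : wlim m n k = wlim 0 0 (k - qA2 m n).
Proof.
have step x y l : wlim x y (l + qA2 x y) = wlim x (y + 1) (l + qA2 x (y + 1)).
  by rewrite -wlim_trans2; congr wlim; rewrite /qA2; lia.
have col x y l : wlim x y (l + qA2 x y) = wlim x 0 (l + qA2 x 0).
  elim/int_rect: y => [//|y IH|y IH].
    by rewrite -IH (step x y%:Z) -PoszD addn1.
  by rewrite -IH (step x (- y.+1%:Z)) (_ : - y.+1%:Z + 1 = - y%:Z) //; lia.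
(* [col] moves [(m, n)] to [(m, 0)], the swap makes it [(0, m)], and [col] applies again. *)
rewrite -{1}(subrK (qA2 m n) k) col -wlim_s2.
have -> : qA2 m 0 = qA2 0 m by rewrite /qA2; lia.
by rewrite col /qA2; congr wlim; lia.
Qed.

Lemma eq_big_supp (R : nmodType) (T : eqType) (L L' : seq T) (F : T -> R) :
  uniq L -> uniq L' ->
  (forall x, F x != 0 -> (x \in L) = (x \in L')) ->
  \sum_(x <- L) F x = \sum_(x <- L') F x.
Proof.
move=> uL uL' eqL.
have restr (K : seq T) :
    \sum_(x <- K) F x = \sum_(x <- [seq y <- K | F y != 0]) F x.
  rewrite big_filter [LHS](bigID (fun y => F y != 0)) /= [X in _ + X]big1 ?addr0 //.
  by move=> x /negbNE /eqP.
rewrite restr [RHS]restr; apply: perm_big; apply: uniq_perm;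
  rewrite ?filter_uniq // => x.
by rewrite !mem_filter; case: (boolP (F x != 0)) => // /eqL.
Qed.

(** * Signed sums over the dot orbits *)

Definition irange (B : nat) : seq int := [seq i%:Z - B%:Z | i <- iota 0 (B + B).+1].
Definition box (B : nat) : seq (int * int) := [seq (s, t) | s <- irange B, t <- irange B].

Lemma mem_irange B s : (s \in irange B) = (`|s| <= B)%N.
Proof.
apply/mapP/idP => [[i]|le_sB]; first by rewrite mem_iota; lia.
by exists `|(s + B%:Z)%R|%N; rewrite ?mem_iota; lia.
Qed.

Lemma irange_uniq B : uniq (irange B).
Proof. by rewrite map_inj_uniq ?iota_uniq // => i j /addIr[]. Qed.

Lemma mem_box B x : (x \in box B) = (`|x.1| <= B)%N && (`|x.2| <= B)%N.
Proof.
apply/allpairsP/idP => [[[s t] /= [+ + ->]]|/andP[s_x t_x]].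
  by rewrite !mem_irange => -> ->.
by exists x; rewrite !mem_irange; split=> //; case: x {s_x t_x}.
Qed.

Lemma box_uniq B : uniq (box B).
Proof. by apply: allpairs_uniq; rewrite ?irange_uniq // => -[? ?] [? ?]. Qed.

(* With the shift by rho = (3, 2), the weights of phi5 and phi3 run through the two
   index 7 sublattices that contain the dot orbit of rho, with signs + and -;
   the energy is r + (qA2 (mu + rho) - qA2 rho) / 7. *)
Definition phi5 (F : int -> int -> int -> int) (r : int) (x : int * int) : int :=
  F (3 * x.1 + x.2 - 3) (2 * x.1 + 3 * x.2 - 2)
    (r + x.1 * x.1 + x.1 * x.2 + x.2 * x.2 - 1).
Definition phi3 (F : int -> int -> int -> int) (r : int) (x : int * int) : int :=
  F (2 * x.1 + 3 * x.2 - 3) (3 * x.1 + x.2 - 2)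
    (r + x.1 * x.1 + x.1 * x.2 + x.2 * x.2 - 1).

Definition phi (B : nat) (F : int -> int -> int -> int) (r : int) : int :=
  \sum_(x <- box B) phi5 F r x - \sum_(x <- box B) phi3 F r x.

Lemma phi_add B (F G : int -> int -> int -> int) r :
  phi B (fun m n k => F m n k + G m n k) r = phi B F r + phi B G r.
Proof. by rewrite /phi [RHS]addrACA -opprD -!big_split. Qed.

Lemma eq_phi B (F G : int -> int -> int -> int) r :
  (forall m n k, F m n k = G m n k) -> phi B F r = phi B G r.
Proof. by move=> eqFG; congr (_ - _); apply: eq_bigr => x _; apply: eqFG. Qed.

(** The weight maps of [phi5] and [phi3] have determinant 7 up to sign. Inverting them bounds the
    coordinates of a term in the support by less than [C + 5], so it does no harm that [tau] moves
    the box. *)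
Lemma phi_anti B C (F : int -> int -> int -> int) r (tau tau' : int * int -> int * int) :
  (forall m n k, F m n k != 0 -> (`|m| <= C)%N && (`|n| <= C)%N) ->
  (C + 5 <= B)%N -> cancel tau tau' -> cancel tau' tau ->
  (forall x, phi5 F r x = phi3 F r (tau x)) -> phi B F r = 0.
Proof.
move=> suppF leCB tauK tauK' eqF; apply/eqP; rewrite subr_eq0; apply/eqP.
rewrite (eq_bigr _ (fun x _ => eqF x)) -(big_map tau xpredT (phi3 F r)).
apply: eq_big_supp => [||x].
- by rewrite (map_inj_uniq (can_inj tauK)) box_uniq.
- exact: box_uniq.
rewrite -{2}[x]tauK' mem_map ?(can_inj tauK) //; last exact: can_inj tauK.
move=> nz; rewrite !mem_box; have := nz; rewrite -{1}[x]tauK' -eqF.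
move/suppF; move/suppF: nz; move: (tau' x) => [s t]; case: x => [s' t'] /= s3 s5.
by apply/idP/idP => _; lia.
Qed.

(** The dot reflections exchange the two sublattices; these are the effects of reflections 1 and 0
    on the coordinates, while reflection 2 leaves the coordinates fixed. *)
Definition tau1 (x : int * int) := (- x.2, x.1 + x.2).
Definition tau1' (x : int * int) := (x.1 + x.2, - x.1).
Definition tau0 (x : int * int) := (2 - x.1, 1 - x.2).

Lemma tau1K : cancel tau1 tau1'.
Proof. by case=> s t; rewrite /tau1 /tau1' /=; congr (_, _); lia. Qed.
Lemma tau1'K : cancel tau1' tau1.
Proof. by case=> s t; rewrite /tau1 /tau1' /=; congr (_, _); lia. Qed.
Lemma tau0K : cancel tau0 tau0.
Proof. by case=> s t; rewrite /tau0 /=; congr (_, _); lia. Qed.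

Section Classes.
Variables (B C : nat) (F : int -> int -> int -> int) (r : int).
Hypothesis suppF : forall m n k, F m n k != 0 -> (`|m| <= C)%N && (`|n| <= C)%N.
Hypothesis le_CB : (C + 5 <= B)%N.

Lemma phi_dot1 : (forall m n k, F m (m - n - 1) k = F m n k) -> phi B F r = 0.
Proof.
move=> inv; apply: (phi_anti suppF le_CB tau1K tau1'K) => -[s t].
by rewrite /phi5 -inv; congr F => /=; ring.
Qed.

Lemma phi_dot2 : (forall m n k, F (n - 1) (m + 1) k = F m n k) -> phi B F r = 0.
Proof.
move=> inv; apply: (@phi_anti _ _ _ _ id id suppF le_CB) => // -[s t].
by rewrite /phi5 -inv; congr F => /=; ring.
Qed.

Lemma phi_dot0 : (forall m n k, F (2 - n) (2 - m) (k - m - n + 2) = F m n k) ->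
  phi B F r = 0.
Proof.
move=> inv; apply: (phi_anti suppF le_CB tau0K tau0K) => -[s t].
by rewrite /phi5 -inv; congr F => /=; ring.
Qed.
End Classes.

Lemma phi_words B N r : (N + 6 <= B)%N -> phi B (words N Ch) r = (r == 0)%:Z.
Proof.
elim: N => [|N IH] leNB.
  (* Only the empty word remains. Weight 0 does not occur in [phi3], and in [phi5] it occurs at
     [(1, 0)] alone, with energy [r]. *)
  rewrite /phi [X in _ - X]big1 ?subr0 => [|x _]; last by rewrite /phi3 /=; lia.
  rewrite (bigD1_seq (1, 0)) ?box_uniq ?mem_box //=; last by lia.
  rewrite big1 ?addr0 => [|[s t] ne]; first by rewrite /phi5 /=; lia.
  have {}ne : (s != 1) || (t != 0).
    by apply: contraR ne; rewrite negb_or !negbK => /andP[/eqP-> /eqP->].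
  by rewrite /phi5 /=; lia.
rewrite (eq_phi _ _ (words_hS N)) !phi_add IH; last by lia.
rewrite (@phi_dot0 _ N.+1) ?add0r; first last.
- by move=> m n k; rewrite -(sym0a (words_sym0 N)); congr words; lia.
- by lia.
- by move=> m n k /words_supp; lia.
rewrite (@phi_dot1 _ N.+1) ?add0r; first last.
- by move=> m n k; rewrite -[RHS](sym1b (words_sym1 N)); congr words; lia.
- by lia.
- by move=> m n k /words_supp; lia.
rewrite (@phi_dot2 _ N.+1) ?add0r; first last.
- by move=> m n k; rewrite -[RHS](sym2d (words_sym2 N)); congr words; lia.
- by lia.
- by move=> m n k /words_supp; lia.
(* Only the sum of these two is invariant: the defect of [d] in [sym1d] is made up for by the
   shifted [e]. *)
rewrite -phi_add (@phi_dot1 _ N.+1) ?add0r; first last.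
- move=> m n k; have := sym1d (words_sym1 N) m (n + 1) (k - N.+1%:Z).
  have := sym1e (words_sym1 N) m n (k - N.+1%:Z); rewrite addrK.
  rewrite (_ : m - (n + 1) = m - n - 1); last by lia.
  rewrite (_ : m - n - 1 + 1 = m - n); last by lia.
  by move=> -> ->; rewrite subrK.
- by lia.
- move=> m n k; case: (eqVneq (words N Cd m n (k - N.+1%:Z)) 0) => [->|/words_supp].
    by rewrite add0r => /words_supp; lia.
  by lia.
rewrite (@phi_dot2 _ N.+1) ?add0r; first last.
- by move=> m n k; rewrite -[RHS](sym2f (words_sym2 N)); congr words; lia.
- by lia.
- by move=> m n k /words_supp; lia.
rewrite (@phi_dot1 _ N.+1) ?add0r //.
- by move=> m n k /words_supp; lia.
- by lia.
- move=> m n k; rewrite !words_gh -[RHS](sym1h (words_sym1 N)); congr words; lia.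
Qed.

Definition wlim0 (k : int) : int := wlim 0 0 k.
(** The norm of the weight in [phi5] minus the energy added to [r] there: the exponents of one half
    of the signed theta series [S]. *)
Definition dot_exp5 (x : int * int) : int :=
  6 * (x.1 * x.1 + x.1 * x.2 + x.2 * x.2) - 14 * x.1 - 7 * x.2 + 8.
Definition dot_exp3 (x : int * int) : int :=
  6 * (x.1 * x.1 + x.1 * x.2 + x.2 * x.2) - 11 * x.1 - 13 * x.2 + 8.

Lemma wlim0_neg k : k < 0 -> wlim0 k = 0.
Proof. exact: words_neg. Qed.

Lemma wlim_wlim0 m n k : wlim m n k = wlim0 (k - qA2 m n).
Proof. exact: wlimE. Qed.

(* Beyond the stable range both sides vanish, since words N is dominated by wlim. *)
Lemma words_wlim0 N m n k : (k <= N%:Z) || (k < qA2 m n) ->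
  words N Ch m n k = wlim0 (k - qA2 m n).
Proof.
case/orP=> [/words_wlim ->|lt_kq]; first exact: wlim_wlim0.
rewrite wlim0_neg; last by lia.
apply/eqP; rewrite eq_le words_ge0 andbT.
have le_N : (N <= N + `|k|)%N by lia.
apply: le_trans (words_mono _ _ _ le_N) _.
by rewrite words_wlim ?wlim_wlim0 ?wlim0_neg; lia.
Qed.

(** Completing the square. In [wlim0_dot] this ensures that a term beyond the stable range has a
    norm larger than its energy. *)
Lemma dot_exp5_ge s t : s * s + s * t + t * t - 2 <= dot_exp5 (s, t).
Proof.
have := sqr_ge0 t; have := sqr_ge0 (5 * (2 * s + t) - 14).
have : 20 * (dot_exp5 (s, t) - (s * s + s * t + t * t) + 2)
     = (5 * (2 * s + t) - 14) ^+ 2 + 75 * t ^+ 2 + 4 by rewrite /dot_exp5 /=; ring.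
by move: (dot_exp5 _) (s * s + _ + _) (_ ^+ 2) (t ^+ 2); lia.
Qed.

Lemma dot_exp3_ge s t : s * s + s * t + t * t - 2 <= dot_exp3 (s, t).
Proof.
have := sqr_ge0 (t - 1); have := sqr_ge0 (5 * (2 * s + t) - 11).
have : 20 * (dot_exp3 (s, t) - (s * s + s * t + t * t) + 2)
     = (5 * (2 * s + t) - 11) ^+ 2 + 75 * (t - 1) ^+ 2 + 4 by rewrite /dot_exp3 /=; ring.
by move: (dot_exp3 _) (s * s + _ + _) (_ ^+ 2) ((t - 1) ^+ 2); lia.
Qed.

(** This is [C(Q) * S(Q) = 1], read off from [phi_words] at a length where each term is stable or
    vanishes. *)
Lemma wlim0_dot r B : (2 * `|r| + 10 <= B)%N ->
  \sum_(x <- box B) wlim0 (r - dot_exp5 x) - \sum_(x <- box B) wlim0 (r - dot_exp3 x)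
  = (r == 0)%:Z.
Proof.
move=> leB; rewrite -(@phi_words B (2 * `|r| + 4) r); last by lia.
congr (_ - _); apply: eq_bigr => -[s t] _; rewrite /phi5 /phi3 /=.
- have e : qA2 (3 * s + t - 3) (2 * s + 3 * t - 2)
      = dot_exp5 (s, t) + (s * s + s * t + t * t) - 1 by rewrite /dot_exp5 /qA2 /=; ring.
  have le := dot_exp5_ge s t; rewrite words_wlim0 e; first by congr wlim0; lia.
  by move: (dot_exp5 _) e le => E _ le; case: leP => //=; lia.
- have e : qA2 (2 * s + 3 * t - 3) (3 * s + t - 2)
      = dot_exp3 (s, t) + (s * s + s * t + t * t) - 1 by rewrite /dot_exp3 /qA2 /=; ring.
  have le := dot_exp3_ge s t; rewrite words_wlim0 e; first by congr wlim0; lia.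
  by move: (dot_exp3 _) e le => E _ le; case: leP => //=; lia.
Qed.

(** * Passage to [q], with [Q = q^4], and pentagonal numbers *)

Definition wlim4 (e : int) : int := if (4 %| e)%Z then wlim0 (e %/ 4)%Z else 0.

Lemma wlim4M k : wlim4 (4 * k) = wlim0 k.
Proof. by rewrite /wlim4 dvdz_mulr ?dvdzz // mulKz. Qed.

Lemma wlim4_neg e : e < 0 -> wlim4 e = 0.
Proof. by rewrite /wlim4; case: ifP => // d4 e0; apply: wlim0_neg; lia. Qed.

(** The two halves are 4 and 12 times generalised pentagonal numbers [i(3i + 1)/2]. *)
Definition pent (x : int * int) : int :=
  6 * (x.1 * x.1) + 2 * x.1 + (18 * (x.2 * x.2) + 6 * x.2).
Definition psign (x : int * int) : int := (-1) ^+ `|(x.1 + x.2)%R|%N.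

Definition to_pent5 (x : int * int) : int * int := (1 - x.1 - 2 * x.2, 1 - x.1).
Definition to_pent3 (x : int * int) : int * int := (2 * x.1 + x.2 - 2, x.2 - 1).

Lemma psignE x : psign x = if (2 %| x.1 + x.2)%Z then 1 else -1.
Proof.
rewrite /psign -signr_odd; case: (boolP (2 %| _)%Z) => d2.
  by rewrite (_ : odd _ = false) //; lia.
by rewrite (_ : odd _ = true) //; lia.
Qed.

Lemma sqr_ge_lin (i : int) : `|i| <= i * i.
Proof. by case: (lerP 0 i) => i0; nia. Qed.

Lemma pent_bound x : 4 * `|x.1| + 12 * `|x.2| <= pent x.
Proof.
by case: x => i j; rewrite /pent /=; move: (sqr_ge_lin i) (sqr_ge_lin j); lia.
Qed.

Lemma pent_dvd x : (4 %| pent x)%Z.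
Proof.
case: x => i j; rewrite /pent /=.
have ev (l : int) : exists y, l * (3 * l + 1) = 2 * y.
  have : l = 2 * (l %/ 2)%Z \/ l = 2 * (l %/ 2)%Z + 1 by lia.
  case; move: (l %/ 2)%Z => y ->; first by exists (y * (6 * y + 1)); ring.
  by exists ((2 * y + 1) * (3 * y + 2)); ring.
have [y ey] := ev i; have [z ez] := ev j.
apply/dvdzP; exists (y + 3 * z).
rewrite (_ : _ + _ = 2 * (i * (3 * i + 1)) + 6 * (j * (3 * j + 1))); last by ring.
by rewrite ey ez; ring.
Qed.

(* Rotating the lattice by the Eisenstein integer of norm 7 that relates the
   two sublattices of phi turns both quadratic forms into sums of two
   generalised pentagonal numbers: even i + j for dot_exp5 and odd i + j for dot_exp3. *)
Lemma wlim4_pent e B : (2 * `|e| + 10 <= B)%N ->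
  \sum_(x <- box B) psign x * wlim4 (e - pent x) = (e == 0)%:Z.
Proof.
move=> leB; case: (boolP (4 %| e)%Z) => [/dvdzP[r er]|ndvd]; last first.
  rewrite big1 => [|x _]; first by case: eqP ndvd => // ->.
  by rewrite /wlim4 rpredBr ?pent_dvd // (negPf ndvd) mulr0.
have {}er : e = 4 * r by rewrite er mulrC.
have -> : (e == 0) = (r == 0) by lia.
rewrite -(@wlim0_dot r B); last by lia.
have inj5 : injective to_pent5 by move=> [s t] [s' t'] [? ?]; congr (_, _); lia.
have inj3 : injective to_pent3 by move=> [s t] [s' t'] [? ?]; congr (_, _); lia.
rewrite (@eq_big_supp _ _ _ ([seq to_pent5 x | x <- box B] ++
                           [seq to_pent3 x | x <- box B])).
- rewrite big_cat !big_map /= -sumrN; congr (_ + _); apply: eq_bigr => -[s t] _.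
    rewrite psignE (_ : (2 %| _)%Z) ?mul1r; last by rewrite /=; lia.
    by rewrite -wlim4M; congr wlim4; rewrite er /pent /dot_exp5 /=; ring.
  rewrite psignE (_ : (2 %| _)%Z = false) ?mulN1r; last by rewrite /=; lia.
  by rewrite -wlim4M; congr (- wlim4 _); rewrite er /pent /dot_exp3 /=; ring.
- exact: box_uniq.
- rewrite cat_uniq !map_inj_uniq ?box_uniq // andbT; apply/hasPn.
  by move=> _ /mapP[[s t] _ ->]; apply/negP => /mapP[[s' t'] _ []]; lia.
move=> x nz; have le_x : pent x <= e.
  rewrite leNgt; apply: contra_neqN nz => lt_e; rewrite wlim4_neg ?mulr0 //; lia.
have le_ij : (`|x.1| <= `|e|)%N && (`|x.2| <= `|e|)%N.
  move: (pent_bound x) le_x.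
  by move: (pent x) x.1 x.2 => p i j; lia.
rewrite mem_box (_ : _ && _ = true) ?[RHS]mem_cat; last by lia.
case: x {nz le_x} le_ij => i j le_ij; rewrite /= in le_ij.
symmetry; apply/orP; case: (boolP (2 %| i + j)%Z) => d2.
  left; apply/mapP; exists (1 - j, ((j - i) %/ 2)%Z); first by rewrite mem_box /=; lia.
  by rewrite /to_pent5 /=; congr (_, _); lia.
right; apply/mapP; exists (((i + 1 - j) %/ 2)%Z, j + 1); first by rewrite mem_box /=; lia.
by rewrite /to_pent3 /=; congr (_, _); lia.
Qed.

(** * The principal grading *)

Definition ht (x : colour) : int := 2 * wt1 x + wt2 x.

Lemma M_energy i j : (M i j)%:Z = 4 * (energy i j)%:Z + ht i - ht j.
Proof. by case: i; case: j. Qed.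

Fixpoint graded (N : nat) (i : colour) (e : int) : int :=
  if N is N'.+1 then \sum_(j <- colours) graded N' j (e - (N * M i j)%N%:Z)
  else (e == 0)%:Z.

Lemma graded_neg N i e : e < 0 -> graded N i e = 0.
Proof.
elim: N i e => [|N IH] i e e0; first by rewrite /=; lia.
by rewrite /= big1 // => j _; apply: IH; lia.
Qed.

Definition words4 N i m n (y : int) : int :=
  if (4 %| y)%Z then words N i m n (y %/ 4)%Z else 0.

(** By [M_energy], the differences [ht i - ht j], weighted by the number of letters they lift,
    telescope to [N * ht i] minus the height [2m + n] of the weight; the rest is 4 times the
    energy. *)
Lemma graded_words N i e B : (N <= B)%N ->
  graded N i e =
  \sum_(x <- box B) words4 N i x.1 x.2 (e + 2 * x.1 + x.2 - N%:Z * ht i).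
Proof.
elim: N i e => [|N IH] i e leNB.
  rewrite (bigD1_seq (0, 0)) ?box_uniq ?mem_box //= big1 ?addr0.
    by rewrite /words4 /=; case: ifP; lia.
  move=> [m n] /negP ne; rewrite /words4 /=; case: ifP => // _.
  by case: eqP => // m0; case: eqP => // n0; case: ne; rewrite m0 n0.
under [RHS]eq_bigr => x _.
  rewrite (_ : words4 _ _ _ _ _ = \sum_(j <- colours)
    words4 N j (x.1 - wt1 j) (x.2 - wt2 j) (e - (N.+1 * M i j)%N%:Z
      + 2 * (x.1 - wt1 j) + (x.2 - wt2 j) - N%:Z * ht j)); last first.
    set y := e + 2 * x.1 + x.2 - _.
    have ey j : e - (N.+1 * M i j)%N%:Z + 2 * (x.1 - wt1 j) + (x.2 - wt2 j)
        - N%:Z * ht j = y - 4 * (N.+1 * energy i j)%N%:Z.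
      by rewrite /y !PoszM M_energy -[N.+1]addn1 PoszD [in - (N%:Z * ht j)]/ht /ht; ring.
    have dvdE (w : nat) : (4 %| y - 4 * w%:Z)%Z = (4 %| y)%Z by lia.
    have divE (w : nat) : (4 %| y)%Z -> ((y - 4 * w%:Z) %/ 4)%Z = (y %/ 4)%Z - w%:Z.
      by lia.
    rewrite {1}/words4; case: (boolP (4 %| y)%Z) => [dvd|/negPf ndvd].
      rewrite [LHS]/=; apply: eq_bigr => j _.
      by rewrite ey /words4 dvdE dvd divE.
    by rewrite big1 // => j _; rewrite ey /words4 dvdE ndvd.
  over.
rewrite exchange_big /=; apply: eq_bigr => j _.
rewrite IH; last by lia.
pose G x := words4 N j x.1 x.2 (e - (N.+1 * M i j)%N%:Z + 2 * x.1 + x.2 - N%:Z * ht j).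
rewrite -(big_map (fun x => (x.1 - wt1 j, x.2 - wt2 j)) xpredT G).
apply: eq_big_supp; rewrite ?box_uniq //.
  by rewrite map_inj_uniq ?box_uniq // => -[? ?] [? ?] [? ?]; congr (_, _); lia.
move=> [m n]; rewrite /words4; case: ifP => // _ /words_supp le_mn; rewrite /= in le_mn.
rewrite mem_box (_ : _ && _ = true); last by rewrite /=; lia.
symmetry; apply/mapP; exists (m + wt1 j, n + wt2 j); last by congr (_, _); rewrite /=; lia.
by rewrite mem_box /=; case: j {G} => /=; lia.
Qed.

Definition theta (x : int * int) : int := 4 * qA2 x.1 x.2 - 2 * x.1 - x.2.

Lemma graded_wlim N (e : nat) B : (e + 2 <= N)%N -> (N <= B)%N ->
  graded N Ch e%:Z = \sum_(x <- box B) wlim4 (e%:Z - theta x).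
Proof.
move=> leN leB; rewrite (graded_words _ _ leB); apply: eq_bigr => -[m n] _.
rewrite mulr0 subr0 /words4 /wlim4 /theta /=.
(* The norm is at least [3 h^2 / 28] with [h = 2m + n]. An energy above [N] forces [h] to be at
   least 12, and then the norm exceeds the energy. *)
have eqq : 28 * qA2 m n = 3 * ((2 * m + n) * (2 * m + n)) + (4 * m - 5 * n) ^+ 2.
  by rewrite /qA2; ring.
have dvdE : (4 %| e%:Z - (4 * qA2 m n - 2 * m - n))%Z = (4 %| e%:Z + 2 * m + n)%Z.
  by move: (qA2 m n) => q; lia.
rewrite dvdE; case: ifP => // dvd.
rewrite words_wlim0; first by congr wlim0; move: (qA2 m n) dvdE => q; lia.
case: (lerP _ N%:Z) => //= gtN.
have hge : 12 <= 2 * m + n by lia.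
have := sqr_ge0 (4 * m - 5 * n).
have : 0 <= (2 * m + n - 12) * (2 * m + n) by apply: mulr_ge0; lia.
move: (_ ^+ 2) (qA2 m n) eqq {dvdE} => sq q; rewrite mulrBl.
by move: (_ * (2 * m + n)) => hh; lia.
Qed.

(** * Truncated power series and the Jacobi triple product *)

Section Truncation.
Variable t : nat.

Definition eqm (p q : {poly int}) : Prop := forall e, (e < t)%N -> p`_e = q`_e.

Lemma eqm_refl p : eqm p p. Proof. by []. Qed.
Lemma eqm_sym p q : eqm p q -> eqm q p.
Proof. by move=> pq e le; rewrite pq. Qed.
Lemma eqm_trans q p r : eqm p q -> eqm q r -> eqm p r.
Proof. by move=> pq qr e le; rewrite pq ?qr. Qed.
Lemma eqmM p p' q q' : eqm p p' -> eqm q q' -> eqm (p * q) (p' * q').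
Proof.
move=> pp qq e le; rewrite !coefM; apply: eq_bigr => i _.
by rewrite pp ?qq //; have := ltn_ord i; lia.
Qed.
Lemma eqm_sum (I : Type) (r : seq I) (P : pred I) (F G : I -> {poly int}) :
  (forall i, P i -> eqm (F i) (G i)) ->
  eqm (\sum_(i <- r | P i) F i) (\sum_(i <- r | P i) G i).
Proof.
by move=> FG e le; rewrite !coef_sum; apply: eq_bigr => i Pi; apply: FG.
Qed.

Lemma eqm_cancel (f p q : {poly int}) : f`_0 = 1 -> eqm (f * p) (f * q) -> eqm p q.
Proof.
move=> f0 fpq e; elim/ltn_ind: e => e IH le.
have := fpq e le; rewrite !coefM !big_ord_recl !subn0 f0 !mul1r.
rewrite (eq_bigr (fun i : 'I_e => f`_(lift ord0 i) * q`_(e - lift ord0 i))).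
  by move/addIr.
by move=> i _; rewrite IH //=; have := ltn_ord i; rewrite /bump /=; lia.
Qed.

Lemma eqm_1X n (s : int) : (t <= n)%N -> eqm (1 + s *: 'X^n) 1.
Proof.
move=> le e lt; rewrite coefD coefZ coefXn (_ : (e == n) = false) ?mulr0 ?addr0 //.
by lia.
Qed.

Lemma eqm_XnM n t' (p q : {poly int}) : (forall e, (e < t')%N -> p`_e = q`_e) ->
  (t <= n + t')%N -> eqm ('X^n * p) ('X^n * q).
Proof. by move=> pq le e lt; rewrite !coefXnM; case: ltnP => // le_ne; apply: pq; lia. Qed.

Lemma eqm_prod_trunc (f : nat -> {poly int}) K L L' :
  (forall m, (K <= m)%N -> eqm (f m) 1) -> (K <= L)%N -> (K <= L')%N ->
  eqm (\prod_(m < L) f m) (\prod_(m < L') f m).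
Proof.
move=> f1.
have to_K J : (K <= J)%N -> eqm (\prod_(m < J) f m) (\prod_(m < K) f m).
  move/subnK <-; elim: (J - K)%N => // k IH; rewrite addSn big_ord_recr /=.
  by rewrite -[X in eqm _ X]mulr1; apply: eqmM IH (f1 _ _); lia.
by move=> leL leL'; apply: eqm_trans (to_K _ leL) (eqm_sym (to_K _ leL')).
Qed.
End Truncation.

Lemma prod_coef0 (f : nat -> {poly int}) L :
  (forall m, (f m)`_0 = 1) -> (\prod_(m < L) f m)`_0 = 1.
Proof.
move=> f1; elim: L => [|L IH]; first by rewrite big_ord0 coef1.
by rewrite big_ord_recr coef0M IH f1 mulr1.
Qed.

Definition euler (k L : nat) : {poly int} := \prod_(m < L) (1 - 'X^(k * m.+1)).

Lemma eulerS k L : euler k L.+1 = euler k L * (1 - 'X^(k * L.+1)).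
Proof. by rewrite /euler big_ord_recr. Qed.

Lemma coef0_1subX n : (0 < n)%N -> (1 - 'X^n : {poly int})`_0 = 1.
Proof. by case: n => // n _; rewrite coefB coef1 coefXn /= subr0. Qed.

Lemma euler0 k L : (0 < k)%N -> (euler k L)`_0 = 1.
Proof.
move=> k0; apply: (@prod_coef0 (fun m => 1 - 'X^(k * m.+1))) => m.
by apply: coef0_1subX; lia.
Qed.

Lemma euler_trunc t k L L' : (t <= k * L.+1)%N -> (t <= k * L'.+1)%N ->
  eqm t (euler k L) (euler k L').
Proof.
move=> leL leL'; apply: (@eqm_prod_trunc _ (fun m => 1 - 'X^(k * m.+1)) (minn L L'));
  rewrite ?geq_minl ?geq_minr // => m le_m.
rewrite -scaleN1r; apply: eqm_1X.
have : (minn L L' == L) || (minn L L' == L') by rewrite /minn; case: ifP; rewrite eqxx ?orbT.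
by case/orP=> /eqP e; [apply: leq_trans leL _|apply: leq_trans leL' _];
  rewrite leq_mul2l ltnS -e le_m orbT.
Qed.

Section JacobiTriple.
Variables (a b : nat) (s : int).
Hypotheses (a_gt0 : (0 < a)%N) (le_ba : (b <= a)%N) (s2 : s * s = 1).
Local Notation Y n := ('X^(2 * a * n) : {poly int}).

(* jcoef n j is (Y; Y)_n times the Gaussian binomial of 2n over n + j in base
   Y = X^(2a); it is defined by the recursion that makes the finite form of the
   triple product hold, and jcoefE is its closed form. *)
Fixpoint jcoef (n : nat) (j : int) : {poly int} :=
  if n is n'.+1 then
    (1 - Y n) * ((1 + Y (2 * n' + 1)) * jcoef n' j
                 + Y `|(n%:Z - j)%R|%N * jcoef n' (j - 1)
                 + Y `|(n%:Z + j)%R|%N * jcoef n' (j + 1))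
  else (j == 0)%:R.

Lemma jcoefS n j : jcoef n.+1 j =
  (1 - Y n.+1) * ((1 + Y (2 * n + 1)) * jcoef n j
                  + Y `|(n.+1%:Z - j)%R|%N * jcoef n (j - 1)
                  + Y `|(n.+1%:Z + j)%R|%N * jcoef n (j + 1)).
Proof. by []. Qed.

(** The absolute values lose nothing: the exponent of [X] is non-negative by [jterm_bound], and [s]
    is its own inverse. *)
Definition jterm (j : int) : {poly int} :=
  (s ^+ `|j|) *: 'X^`|(a%:Z * (j * j) + b%:Z * j)%R|.

Lemma jcoefN n j : jcoef n (- j) = jcoef n j.
Proof.
elim: n j => [|n IH] j /=; first by rewrite oppr_eq0.
rewrite IH opprK addrAC; congr (_ * (_ + _ + _)).
  by rewrite -IH; congr (_ * jcoef _ _); lia.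
by rewrite -IH; congr (_ * jcoef _ _); lia.
Qed.

Lemma jcoef_out n j : (n < `|j|)%N -> jcoef n j = 0.
Proof.
elim: n j => [|n IH] j lt_nj /=; first by rewrite (_ : (j == 0) = false) //; lia.
by rewrite !IH ?mulr0 ?addr0 ?mulr0 //; lia.
Qed.

Lemma exp_sS (j : int) : s * s ^+ `|j| = s ^+ `|(j + 1)%R|.
Proof.
have sgn (i : nat) : s ^+ i = if odd i then s else 1.
  by elim: i => [|i IH] //=; rewrite exprS IH; case: (odd i); rewrite ?mulr1.
rewrite !sgn (_ : odd `|(j + 1)%R| = ~~ odd `|j|); last by lia.
by case: (odd _); rewrite ?mulr1.
Qed.

Lemma jterm_bound (j : int) : 0 <= a%:Z * (j * j) + b%:Z * j.
Proof.
have : `|j| <= j * j by apply: sqr_ge_lin.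
move: (j * j) => jj le_j.
apply: le_trans (_ : a%:Z * `|j| - b%:Z * `|j| <= _).
  by rewrite -mulrBl mulr_ge0 //; lia.
apply: lerD; first by rewrite ler_wpM2l.
by rewrite lerNl -mulrN ler_wpM2l //; lia.
Qed.

Lemma jterm_up n (j : int) : j <= n%:Z ->
  (s *: 'X^(2 * a * n + a + b)) * jterm j
  = jterm (j + 1) * Y `|(n.+1%:Z - (j + 1))%R|%N.
Proof.
move=> le_jn; rewrite /jterm -!scalerAl -!scalerAr scalerA exp_sS; congr (_ *: _).
rewrite -!exprD; congr ('X^_); apply/eqP; rewrite -eqz_nat !PoszD !PoszM.
rewrite !gez0_abs ?jterm_bound //; last by lia.
by apply/eqP; rewrite -[n.+1]addn1 PoszD; ring.
Qed.

Lemma jterm_down n (j : int) : - n%:Z <= j ->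
  (s *: 'X^(2 * a * n + a - b)) * jterm j
  = jterm (j - 1) * Y `|(n.+1%:Z + (j - 1))%R|%N.
Proof.
move=> le_jn; rewrite /jterm -!scalerAl -!scalerAr scalerA.
have <- : s * s ^+ `|j| = s ^+ `|(j - 1)%R|.
  by rewrite -[in LHS](subrK 1 j) -exp_sS mulrA s2 mul1r.
congr (_ *: _); rewrite -!exprD; congr ('X^_); apply/eqP; rewrite -eqz_nat.
rewrite PoszD -subzn; last by lia.
rewrite !PoszD !PoszM !gez0_abs ?jterm_bound //; last by lia.
by apply/eqP; rewrite -[n.+1]addn1 PoszD; ring.
Qed.

(** Let the new factors be [1 + u] and [1 + v]. Up to a power of [Y], [u] and [v] move the term [j]
    to [j + 1] and [j - 1], and [u v = Y (2 * n + 1)]: this is the recursion of [jcoef]. *)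
Lemma jacobi_finite n :
  \prod_(m < n) ((1 - Y m.+1) * (1 + s *: 'X^(2 * a * m + a + b))
                              * (1 + s *: 'X^(2 * a * m + a - b)))
  = \sum_(j <- irange n) jterm j * jcoef n j.
Proof.
elim: n => [|n IH].
  rewrite big_ord0 (_ : irange 0 = [:: 0]) // big_seq1 mulr1 /jterm.
  by rewrite (_ : `|(a%:Z * (0 * 0) + b%:Z * 0)%R|%N = 0%N) ?scale1r //; lia.
rewrite big_ord_recr /= {}IH mulr_suml.
have widen (F : int -> {poly int}) :
    (forall j, (n < `|j|)%N -> F j = 0) ->
    \sum_(j <- irange n) F j = \sum_(j <- irange n.+1) F j.
  move=> F0; apply: eq_big_supp; rewrite ?irange_uniq // => j nz.
  rewrite !mem_irange; case: (leqP `|j| n) => [le_jn|/F0 e]; last by rewrite e eqxx in nz.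
  by rewrite leqW.
have shift (d : int) (F : int -> {poly int}) : (`|d| <= 1)%N ->
    (forall j, (n < `|j|)%N -> F j = 0) ->
    \sum_(j <- irange n) F j = \sum_(j <- irange n.+1) F (j - d).
  move=> d1 F0; rewrite -(big_map (fun j => j - d) xpredT F).
  apply: eq_big_supp; rewrite ?irange_uniq //.
    by rewrite map_inj_uniq ?irange_uniq // => i j /addIr.
  move=> j nz; rewrite mem_irange; case: (leqP `|j| n) => [le_jn|/F0 e].
    symmetry; apply/mapP; exists (j + d); last by rewrite addrK.
    by rewrite mem_irange; lia.
  by rewrite e eqxx in nz.
pose F0 j := jterm j * ((1 + Y (2 * n + 1)) * jcoef n j).
pose F1 j := jterm (j + 1) * (Y `|(n.+1%:Z - (j + 1))%R|%N * jcoef n j).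
pose F2 j := jterm (j - 1) * (Y `|(n.+1%:Z + (j - 1))%R|%N * jcoef n j).
have -> : \sum_(j <- irange n) jterm j * jcoef n j * ((1 - Y n.+1)
    * (1 + s *: 'X^(2 * a * n + a + b)) * (1 + s *: 'X^(2 * a * n + a - b)))
  = (1 - Y n.+1) * (\sum_(j <- irange n) F0 j + \sum_(j <- irange n) F1 j
                    + \sum_(j <- irange n) F2 j).
  rewrite -!big_split /= mulr_sumr; apply: eq_big_seq => j; rewrite mem_irange => le_jn.
  rewrite /F0 /F1 /F2 !mulrA -jterm_up -?jterm_down; try lia.
  have -> : Y (2 * n + 1) = (s *: 'X^(2 * a * n + a + b)) * (s *: 'X^(2 * a * n + a - b)).
    by rewrite -scalerAl -scalerAr scalerA s2 scale1r -exprD; congr ('X^_); nia.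
  by move: (s *: _) (s *: _) => u v; ring.
rewrite (widen F0) => [|j /jcoef_out e]; last by rewrite /F0 e !mulr0.
rewrite (shift 1 F1) // => [|j /jcoef_out e]; last by rewrite /F1 e !mulr0.
rewrite (shift (-1) F2) // => [|j /jcoef_out e]; last by rewrite /F2 e !mulr0.
rewrite -!big_split mulr_sumr; apply: eq_bigr => j _ /=.
by rewrite /F0 /F1 /F2 !subrK !opprK; ring.
Qed.

(** Cross-multiplied to avoid division. Multiplied by the common factor [P], the three neighbours in
    the recursion become explicit multiples of [R]. *)
Lemma jcoefE n k : (k <= n)%N ->
  jcoef n k%:Z * (euler (2 * a) (n - k) * euler (2 * a) (n + k))
  = euler (2 * a) n * euler (2 * a) (2 * n).
Proof.
have E0 : euler (2 * a) 0 = 1 by rewrite /euler big_ord0.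
elim: n k => [|n IH] k le_kn.
  have -> : k = 0%N by lia.
  by rewrite sub0n addn0 muln0 E0 !mulr1.
have eS := eulerS (2 * a).
have -> : (2 * n.+1 = (2 * n).+2)%N by lia.
set P := euler _ (n.+1 - k) * _; rewrite !eS.
set R := euler _ n * euler _ (2 * n) in IH *.
have [le_kn'|eq_kn] : (k <= n)%N \/ k = n.+1 by lia.
  have EP : P = euler (2 * a) (n - k) * euler (2 * a) (n + k)
                * ((1 - Y (n - k).+1) * (1 - Y (n + k).+1)).
    by rewrite /P subSn // addSn !eS; ring.
  have c0 : jcoef n k%:Z * P = R * ((1 - Y (n - k).+1) * (1 - Y (n + k).+1)).
    by rewrite EP mulrA IH.
  have c1 : jcoef n (k%:Z + 1) * P = R * ((1 - Y (n - k)) * (1 - Y (n - k).+1)).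
    have [lt_kn|eq_kn] : (k < n)%N \/ k = n by lia.
      have -> : k%:Z + 1 = k.+1%:Z by lia.
      rewrite -(IH k.+1) // /P subSn // addSn -addnS.
      have -> : ((n - k) = (n - k.+1).+1)%N by lia.
      by rewrite !eS; ring.
    rewrite jcoef_out; last by lia.
    by rewrite eq_kn subnn muln0 expr0; ring.
  have c2 : jcoef n (k%:Z - 1) * P = R * ((1 - Y (n + k)) * (1 - Y (n + k).+1)).
    case: (posnP k) => [k0|k_gt0].
      by rewrite -jcoefN -[- (_ - _)](_ : k%:Z + 1 = _) ?c1 ?k0 ?addn0 ?subn0 //; lia.
    have -> : k%:Z - 1 = k.-1%:Z by lia.
    rewrite -(IH k.-1); last by lia.
    rewrite /P addSn; have -> : (n + k = (n + k.-1).+1)%N by lia.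
    have -> : (n.+1 - k = n - k.-1)%N by lia.
    by rewrite !eS; ring.
  (* What is left is a polynomial identity in [Y (n - k)], [Y (n + k)] and [Y 1]. *)
  have Yn1 (m : nat) : Y m.+1 = Y m * Y 1 by rewrite -exprD; congr ('X^_); lia.
  have Y2n : Y (2 * n) = Y (n - k) * Y (n + k).
    by rewrite -exprD; congr ('X^_); rewrite -mulnDr; congr (_ * _)%N; lia.
  have -> : jcoef n.+1 k%:Z * P = (1 - Y n.+1) *
      ((1 + Y (2 * n + 1)) * (jcoef n k%:Z * P)
       + Y (n - k).+1 * (jcoef n (k%:Z - 1) * P)
       + Y (n + k).+1 * (jcoef n (k%:Z + 1) * P)).
    rewrite jcoefS; have -> : `|(n.+1%:Z - k%:Z)%R|%N = (n - k).+1 by lia.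
    have -> : `|(n.+1%:Z + k%:Z)%R|%N = (n + k).+1 by lia.
    by ring.
  rewrite c0 c1 c2 addn1 [Y (2 * n).+2]Yn1 !(Yn1 (2 * n)%N) Y2n !(Yn1 (n - k)%N).
  rewrite !(Yn1 (n + k)%N) -/(euler (2 * a) _).
  have -> : euler (2 * a) n * (1 - Y n.+1) * (euler (2 * a) (2 * n)
      * (1 - Y (n - k) * Y (n + k) * Y 1) * (1 - Y (n - k) * Y (n + k) * Y 1 * Y 1))
    = (1 - Y n.+1) * (R * ((1 - Y (n - k) * Y (n + k) * Y 1)
      * (1 - Y (n - k) * Y (n + k) * Y 1 * Y 1))) by rewrite /R; ring.
  by congr (_ * _); clearbody R; ring.
have out1 : jcoef n n.+1%:Z = 0 by apply: jcoef_out; lia.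
have out2 : jcoef n (n.+1%:Z + 1) = 0 by apply: jcoef_out; lia.
rewrite {}/P eq_kn subnn jcoefS out1 out2 !mulr0 add0r addr0.
have -> : n.+1%:Z - 1 = n%:Z by lia.
rewrite subrr muln0 expr0 mul1r.
have := IH n (leqnn n); rewrite subnn addnn -mul2n => IHn.
have -> : (n.+1 + n.+1 = (2 * n).+2)%N by lia.
move: IHn; rewrite !eS E0 !mul1r => IHn.
transitivity ((1 - Y n.+1) * (jcoef n n * euler (2 * a) (2 * n))
   * (1 - Y (2 * n).+1) * (1 - Y (2 * n).+2)); first by ring.
by rewrite IHn /R; ring.
Qed.

(** By [jcoefE], [jcoef n j] is 1 below degree [2a(n - |j| + 1)], while [jterm j] has degree at
    least [a(j^2 - |j|)]; the sum of the two is at least [n]. *)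
Lemma jacobi_trunc t n : (t <= n)%N ->
  eqm t (\prod_(m < n) ((1 - Y m.+1) * (1 + s *: 'X^(2 * a * m + a + b))
                                     * (1 + s *: 'X^(2 * a * m + a - b))))
        (\sum_(j <- irange n) jterm j).
Proof.
move=> le_tn; rewrite jacobi_finite big_seq [X in eqm _ _ X]big_seq.
apply: eqm_sum => j; rewrite mem_irange => le_jn.
rewrite /jterm -scalerAl -[X in eqm _ _ (_ *: X)]mulr1 => e lt_e.
rewrite !coefZ; congr (_ * _); move: e lt_e.
have -> : jcoef n j = jcoef n `|j|%N.
  by case: (intP j) => [|k|k] //; rewrite jcoefN.
apply: (@eqm_XnM _ _ (2 * a * (n - `|j|).+1)).
  apply: (@eqm_cancel _ (euler (2 * a) (n - `|j|) * euler (2 * a) (n + `|j|))).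
    by rewrite coef0M !euler0 ?mulr1 //; lia.
  rewrite mulr1 mulrC jcoefE //.
  by apply: eqmM; apply: euler_trunc; rewrite leq_mul2l; apply/orP; right; lia.
have w0 := jterm_bound j.
have bj : 0 <= (a%:Z - b%:Z) * `|j| by rewrite mulr_ge0 //; lia.
have jj : j * j = (`|j| * `|j|)%N%:Z by rewrite PoszM; case: (intP j) => *; lia.
(* This is [(|j| - 1)(|j| - 2) >= 0], times [a]. *)
have le1 : (a * (2 * n + `|j|) <= a * (`|j| * `|j| + 2 * (n - `|j|).+1))%N.
  by rewrite leq_mul2l; apply/orP; right; case: `|j|%N le_jn => [|[|k]]; nia.
have le2 : (a * (`|j| * `|j|) <= `|(a%:Z * (j * j) + b%:Z * j)%R| + a * `|j|)%N.
  rewrite -lez_nat PoszD gez0_abs // jj !PoszM.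
  have : - (b%:Z * j) <= b%:Z * `|j| by rewrite -mulrN ler_wpM2l //; lia.
  by move: bj; rewrite mulrBl abszE; lia.
have le3 : (n <= a * n)%N by rewrite leq_pmull.
by rewrite !mulnDr in le1; lia.
Qed.
End JacobiTriple.

(** * Comparison of the generating functions *)

Lemma coef_natpoly t (f : nat -> nat) e : (e < t)%N ->
  (\poly_(e < t) (f e)%:Z)`_e = (f e)%:Z.
Proof. by move=> lt; rewrite coef_poly lt. Qed.

Definition tower_poly t N i : {poly int} := \poly_(e < t) (tower_count N i e)%:Z.
Definition graded_poly t N i : {poly int} := \poly_(e < t) graded N i e%:Z.

Lemma tower_polyS t N i : eqm t (tower_poly t N.+1 i * (1 - 'X^(4 * N.+1)))
  (\sum_(j <- colours) 'X^(N.+1 * M i j) * tower_poly t N j).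
Proof.
move=> e lt; rewrite mulrBr mulr1 coefB coefMXn coef_sum coef_natpoly // tower_countS.
have -> : (if (e < 4 * N.+1)%N then 0 else (tower_poly t N.+1 i)`_(e - 4 * N.+1))
  = (if (4 * N.+1 <= e)%N then tower_count N.+1 i (e - 4 * N.+1) else 0%N)%:Z.
  by case: ltnP => // le_e; rewrite coef_natpoly //; lia.
rewrite PoszD addrK (big_morph Posz PoszD (erefl _)) [LHS]big_mkcond /=.
apply: eq_bigr => j _; rewrite coefXnM.
by case: ltnP => // le_e; rewrite coef_natpoly //; lia.
Qed.

Lemma graded_polyS t N i :
  eqm t (graded_poly t N.+1 i) (\sum_(j <- colours) 'X^(N.+1 * M i j) * graded_poly t N j).
Proof.
move=> e lt; rewrite coef_poly lt coef_sum.
rewrite (_ : graded N.+1 i e = \sum_(j <- colours) graded N j (e%:Z - (N.+1 * M i j)%N%:Z)) //.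
apply: eq_bigr => j _.
rewrite coefXnM; case: ltnP => le_e; first by rewrite graded_neg //; lia.
by rewrite coef_poly ifT; [congr graded; lia | lia].
Qed.

(** Compared with [graded], the towers gain a factor [1 / (1 - q^(4N))] at each length [N]; together
    these count the partition into multiples of 4. *)
Lemma tower_graded_poly t N i : eqm t (tower_poly t N i * euler 4 N) (graded_poly t N i).
Proof.
elim: N i => [|N IH] i.
  rewrite /euler big_ord0 mulr1 => e lt; rewrite !coef_poly lt.
  by rewrite /tower_count /=; case: e {lt}.
have -> : tower_poly t N.+1 i * euler 4 N.+1
    = tower_poly t N.+1 i * (1 - 'X^(4 * N.+1)) * euler 4 N by rewrite eulerS; ring.
apply: eqm_trans (eqmM (@tower_polyS t N i) (@eqm_refl t _)) _.
rewrite mulr_suml; apply: eqm_sym; apply: eqm_trans (@graded_polyS t N i) _.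
apply: eqm_sum => j _; rewrite -mulrA; apply: eqmM; first exact: eqm_refl.
exact: eqm_sym.
Qed.

Definition cpart_poly t K : {poly int} := \poly_(e < t) (cpart_count K e)%:Z.
Definition c_factor (k : nat) : {poly int} := if c_part k then 1 - 'X^k else 1.

Lemma cpart_polyS t K : eqm t (cpart_poly t K.+1 * c_factor K.+1) (cpart_poly t K).
Proof.
move=> e lt; rewrite /c_factor [RHS]coef_natpoly //; have := cpart_countS K e.
case: (c_part K.+1) => /= eS; last by rewrite mulr1 coef_natpoly // eS addn0.
rewrite mulrBr mulr1 coefB coefMXn coef_natpoly // eS ltnS.
case: (ltnP K e) => [lt_e|le_e]; last by rewrite addn0 subr0.
by rewrite coef_natpoly ?PoszD ?addrK //; lia.
Qed.

Lemma cpart_poly_prod t K : eqm t (cpart_poly t K * \prod_(k < K) c_factor k.+1) 1.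
Proof.
elim: K => [|K IH].
  rewrite big_ord0 mulr1 => e lt; rewrite coef_natpoly // coef1 cpart_count0.
  by case: e {lt}.
rewrite big_ord_recr /=.
have -> (p q r : {poly int}) : p * (q * r) = p * r * q by ring.
by apply: eqm_trans IH; apply: eqmM (@eqm_refl _ _); apply: cpart_polyS.
Qed.

Definition prod15 (L : nat) : {poly int} :=
  \prod_(m < L) ((1 - 'X^(6 * m + 1)) * (1 - 'X^(6 * m + 5))).

(** Modulo 12 the admissible residues are 0, 4, 8, the multiples of 4, and 1, 5, 7, 11, two periods
    modulo 6. *)
Lemma prod_c_factor L :
  \prod_(k < 12 * L) c_factor k.+1 = euler 4 (3 * L) * prod15 (2 * L).
Proof.
elim: L => [|L IH]; first by rewrite /euler /prod15 !big_ord0 mulr1.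
have -> : (12 * L.+1 = (12 * L).+4.+4.+4)%N by lia.
have -> : (3 * L.+1 = (3 * L).+3)%N by lia.
have -> : (2 * L.+1 = (2 * L).+2)%N by lia.
rewrite !big_ord_recr IH /= !eulerS /prod15 !big_ord_recr /= -/(prod15 (2 * L)).
have cT (j : nat) : c_part (12 * L + j) = c_part j.
  by rewrite /c_part; congr [|| _, _ | _]; lia.
have f1 (j : nat) k : k = (12 * L + j)%N -> c_part j -> c_factor k = 1 - 'X^k.
  by rewrite /c_factor => ->; rewrite cT => ->.
have f0 (j : nat) k : k = (12 * L + j)%N -> ~~ c_part j -> c_factor k = 1.
  by rewrite /c_factor => ->; rewrite cT => /negPf->.
rewrite (f1 1%N (12 * L).+1) ?(f0 2%N (12 * L).+2) ?(f0 3%N (12 * L).+3) ?(f1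
  4%N (12 * L).+4) ?(f1 5%N (12 * L).+1.+4) ?(f0 6%N (12 * L).+2.+4) ?(f1 7%N
  (12 * L).+3.+4) ?(f1 8%N (12 * L).+4.+4) ?(f0 9%N (12 * L).+1.+4.+4) ?(f0 10%N
  (12 * L).+2.+4.+4) ?(f1 11%N (12 * L).+3.+4.+4) ?(f1 12%N (12 * L).+4.+4.+4)
  //; try lia.
have -> : (4 * (3 * L).+1 = (12 * L).+4)%N by lia.
have -> : (4 * (3 * L).+2 = (12 * L).+4.+4)%N by lia.
have -> : (4 * (3 * L).+3 = (12 * L).+4.+4.+4)%N by lia.
have -> : (6 * (2 * L) + 1 = (12 * L).+1)%N by lia.
have -> : (6 * (2 * L) + 5 = (12 * L).+4.+1)%N by lia.
have -> : (6 * (2 * L).+1 + 1 = (12 * L).+4.+3)%N by lia.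
have -> : (6 * (2 * L).+1 + 5 = (12 * L).+4.+4.+3)%N by lia.
by ring.
Qed.

Definition wlim_poly t : {poly int} := \poly_(e < t) wlim4 e%:Z.
Definition theta_poly B : {poly int} := \sum_(x <- box B) 'X^`|theta x|%N.
Definition pent_poly B : {poly int} := \sum_(x <- box B) psign x *: 'X^`|pent x|%N.

Lemma coef_wlim_poly t (w : int) e : 0 <= w -> (e < t)%N ->
  (wlim_poly t * 'X^`|w|%N)`_e = wlim4 (e%:Z - w).
Proof.
move=> w0 lt; rewrite coefMXn; case: ltnP => le_e; first by rewrite wlim4_neg //; lia.
by rewrite coef_poly ifT; [congr wlim4; lia | lia].
Qed.

Definition wt_JTP (x : int * int) : int :=
  (1 * (x.1 * x.1) + 1 * x.1) + (3 * (x.2 * x.2) + 2 * x.2).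

(** This change of coordinates diagonalises the quadratic form of A2. *)
Lemma thetaE m n : theta (m, n) = wt_JTP (n - 2 * m, - n).
Proof. by rewrite /theta /wt_JTP /qA2 /=; ring. Qed.

Lemma wt_JTP_bound i j : `|i| + `|j| <= wt_JTP (i, j) + 1.
Proof.
have := sqr_ge_lin (i + 1); have := sqr_ge_lin j; rewrite /wt_JTP /=.
have -> : (i + 1) * (i + 1) = i * i + 2 * i + 1 by ring.
have := sqr_ge_lin i.
move: (i * i) (j * j) => ii jj; lia.
Qed.

Lemma wt_JTP_ge0 i j : 0 <= wt_JTP (i, j).
Proof.
have := sqr_ge_lin i; have := sqr_ge_lin j; rewrite /wt_JTP /=.
by move: (i * i) (j * j) => ii jj; lia.
Qed.

Lemma graded_wlim_poly t N B : (t + 2 <= N)%N -> (N <= B)%N ->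
  eqm t (graded_poly t N Ch) (wlim_poly t * theta_poly B).
Proof.
move=> leN leB e lt; rewrite coef_poly lt (@graded_wlim _ _ B) //; last by lia.
rewrite mulr_sumr coef_sum; apply: eq_bigr => -[m n] _.
by rewrite coef_wlim_poly // thetaE wt_JTP_ge0.
Qed.

Lemma wlim_pent_poly t B : (2 * t + 10 <= B)%N ->
  eqm t (wlim_poly t * pent_poly B) 1.
Proof.
move=> leB e lt; rewrite mulr_sumr coef_sum coef1 natz -[RHS](@wlim4_pent e%:Z B).
  apply: eq_bigr => x _; rewrite -scalerAr coefZ coef_wlim_poly //.
  by have := pent_bound x; lia.
by lia.
Qed.

Lemma euler3 k n : euler k (3 * n) =
  \prod_(m < n) ((1 - 'X^(3 * k * m.+1)) * (1 - 'X^(3 * k * m + 2 * k))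
                                         * (1 - 'X^(3 * k * m + k))).
Proof.
elim: n => [|n IH]; first by rewrite /euler !big_ord0.
rewrite big_ord_recr /= -IH; have -> : (3 * n.+1 = (3 * n).+3)%N by lia.
rewrite !eulerS.
have -> : (3 * k * n.+1 = k * (3 * n).+3)%N by lia.
have -> : (3 * k * n + 2 * k = k * (3 * n).+2)%N by lia.
have -> : (3 * k * n + k = k * (3 * n).+1)%N by lia.
by ring.
Qed.

(** The pentagonal number theorem, twice: the triple product with [s = -1] and [a = 3b], whose three
    factors run through the residues modulo 3 as in [euler3]. *)
Lemma pent_euler t B : (t <= B)%N ->
  eqm t (pent_poly B) (euler 4 (3 * B) * euler 12 (3 * B)).
Proof.
move=> le_tB; have m1 : (-1 : int) * (-1) = 1 by [].
have -> : pent_poly B = (\sum_(i <- irange B) jterm 6 2 (-1) i)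
                      * (\sum_(j <- irange B) jterm 18 6 (-1) j).
  rewrite mulr_suml /pent_poly /box big_allpairs_dep /=; apply: eq_bigr => i _.
  rewrite mulr_sumr; apply: eq_bigr => j _.
  rewrite /jterm -scalerAl -scalerAr scalerA -!exprD; congr (_ *: 'X^_).
    rewrite /psign -signr_odd -[RHS]signr_odd /=; congr (_ ^+ nat_of_bool _).
    by lia.
  have := @jterm_bound 6 2 (-1) isT isT m1 i.
  have := @jterm_bound 18 6 (-1) isT isT m1 j.
  by rewrite /pent /=; move: (i * i) (j * j) => ii jj; lia.
have jac c d : (0 < c)%N -> (d <= c)%N -> (2 * c = 3 * (2 * d))%N ->
    eqm t (\sum_(j <- irange B) jterm c d (-1) j) (euler (2 * d) (3 * B)).
  move=> c0 le_dc cd; apply: eqm_sym.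
  apply: eqm_trans (jacobi_trunc c0 le_dc m1 le_tB).
  have -> : euler (2 * d) (3 * B) = \prod_(m < B) ((1 - 'X^(2 * c * m.+1))
      * (1 + (-1) *: 'X^(2 * c * m + c + d)) * (1 + (-1) *: 'X^(2 * c * m + c - d))).
    rewrite euler3; apply: eq_bigr => m _; rewrite !scaleN1r -cd.
    by congr ((1 - 'X^_) * (1 - 'X^_) * (1 - 'X^_)); lia.
  exact: eqm_refl.
by apply: eqmM; apply: jac.
Qed.

Lemma eqmMl t (r p q : {poly int}) : eqm t p q -> eqm t (r * p) (r * q).
Proof. by move=> pq; apply: eqmM. Qed.

(* (m, n) -> (n - 2m, -n) reaches the points of even coordinate sum; the symmetry
   i -> -1 - i of i^2 + i then gives the odd ones, hence the factor 2. *)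
Lemma theta_JTP t B : (2 * t + 2 <= B)%N ->
  eqm t (theta_poly B + theta_poly B)
    ((\sum_(i <- irange B) jterm 1 1 1 i) * (\sum_(j <- irange B) jterm 3 2 1 j)).
Proof.
move=> leB.
have -> : (\sum_(i <- irange B) jterm 1 1 1 i) * (\sum_(j <- irange B) jterm 3 2 1 j)
    = \sum_(x <- box B) 'X^`|wt_JTP x|%N.
  rewrite mulr_suml [RHS]big_allpairs_dep /=; apply: eq_bigr => i _.
  rewrite mulr_sumr; apply: eq_bigr => j _.
  rewrite /jterm !expr1n !scale1r -exprD; congr ('X^_).
  have := @jterm_bound 1 1 1 isT isT (mulr1 1) i.
  have := @jterm_bound 3 2 1 isT isT (mulr1 1) j.
  by rewrite /wt_JTP /=; move: (i * i) (j * j) => ii jj; lia.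
move=> e lt; rewrite coefD /theta_poly !coef_sum.
pose F x := ('X^`|wt_JTP x|%N : {poly int})`_e.
pose f1 (x : int * int) := (x.2 - 2 * x.1, - x.2).
pose f2 (x : int * int) := (2 * x.1 - x.2 - 1, - x.2).
have F1 x : ('X^`|theta x|%N : {poly int})`_e = F (f1 x).
  by case: x => m n; rewrite /F -thetaE.
have F2 x : F (f1 x) = F (f2 x).
  by case: x => m n; rewrite /F /wt_JTP /=; congr (('X^_ : {poly int})`_e); lia.
rewrite (eq_bigr _ (fun x _ => F1 x)).
rewrite [X in _ + X](eq_bigr _ (fun x _ => F2 x)).
rewrite -(big_map f1 xpredT F) -(big_map f2 xpredT F) -big_cat.
have inj1 : injective f1 by move=> [m n] [m' n'] [? ?]; congr (_, _); lia.
have inj2 : injective f2 by move=> [m n] [m' n'] [? ?]; congr (_, _); lia.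
apply: eq_big_supp; rewrite ?box_uniq //.
  rewrite cat_uniq !map_inj_uniq ?box_uniq // andbT; apply/hasPn.
  by move=> _ /mapP[[m n] _ ->]; apply/negP => /mapP[[m' n'] _ []]; lia.
move=> [i j]; rewrite /F coefXn; case: eqP => // e_w _.
have le_ij : (`|i| <= t.+1)%N && (`|j| <= t.+1)%N.
  have := wt_JTP_bound i j; have := wt_JTP_ge0 i j.
  by move: (wt_JTP (i, j)) e_w => w; lia.
rewrite [RHS]mem_box (_ : _ && _ = true); last by rewrite /=; lia.
rewrite mem_cat; apply/orP; case: (boolP (2 %| i + j)%Z) => d2.
  left; apply/mapP; exists (((- j - i) %/ 2)%Z, - j).
    by rewrite mem_box /=; lia.
  by rewrite /f1 /=; congr (_, _); lia.
right; apply/mapP; exists (((i + 1 - j) %/ 2)%Z, - j).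
  by rewrite mem_box /=; lia.
by rewrite /f2 /=; congr (_, _); lia.
Qed.

(** The product [(-q^k; q^k)_L]; similarly [oddprod k n] is [(q^k; q^(2k))_n]. *)
Definition eulerp (k L : nat) : {poly int} := \prod_(m < L) (1 + 'X^(k * m.+1)).
Definition oddprod (k n : nat) : {poly int} :=
  \prod_(m < n) (1 - 'X^(k * (2 * m + 1))).

Lemma euler_odd k n : euler k (2 * n) = oddprod k n * euler (2 * k) n.
Proof.
elim: n => [|n IH]; first by rewrite /euler /oddprod !big_ord0 mulr1.
have -> : (2 * n.+1 = (2 * n).+2)%N by lia.
rewrite !eulerS IH /oddprod big_ord_recr /= -/(oddprod k n).
have -> : (2 * k * n.+1 = k * (2 * n).+2)%N by lia.
by rewrite addn1; ring.
Qed.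

Lemma euler_eulerp k L : euler k L * eulerp k L = euler (2 * k) L.
Proof.
rewrite -big_split; apply: eq_bigr => m _ /=.
have -> : (2 * k * m.+1 = k * m.+1 + k * m.+1)%N by lia.
by rewrite exprD; ring.
Qed.

Lemma eulerp_trunc t k L L' : (0 < k)%N -> (t <= L)%N -> (t <= L')%N ->
  eqm t (eulerp k L) (eulerp k L').
Proof.
move=> k0 leL leL'; apply: (@eqm_prod_trunc _ (fun m => 1 + 'X^(k * m.+1)) t) => //.
by move=> m le_m; rewrite -[X in 1 + X]scale1r; apply: eqm_1X; nia.
Qed.

(** Euler's theorem on odd and distinct parts, from [(q; q) = (q; q^2) (q^2; q^2)] and
    [(q; q) (-q; q) = (q^2; q^2)]. *)
Lemma oddprod_eulerp t k n : (0 < k)%N -> (t <= n)%N ->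
  eqm t (oddprod k n * eulerp k (2 * n)) 1.
Proof.
move=> k0 le_tn; apply: (@eqm_cancel _ (euler (2 * k) n)).
  by rewrite euler0 //; lia.
rewrite mulr1 mulrA [_ * oddprod _ _]mulrC -euler_odd euler_eulerp.
by apply: euler_trunc; nia.
Qed.

Definition prod210 (n : nat) : {poly int} :=
  \prod_(m < n) ((1 - 'X^(12 * m + 2)) * (1 - 'X^(12 * m + 10))).

(** An odd multiple of 2 is 2, 6 or 10 modulo 12, and those congruent to 6 are the odd multiples of
    6. *)
Lemma prod210_odd n : prod210 n * oddprod 6 n = oddprod 2 (3 * n).
Proof.
elim: n => [|n IH]; first by rewrite /prod210 /oddprod !big_ord0 mulr1.
have -> : (3 * n.+1 = (3 * n).+3)%N by lia.
rewrite /oddprod !big_ord_recr /= -/(oddprod 2 (3 * n)) -IH.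
rewrite /prod210 big_ord_recr /= -/(prod210 n) -/(oddprod 6 n).
have -> : (2 * (2 * (3 * n) + 1) = 12 * n + 2)%N by lia.
have -> : (2 * (2 * (3 * n).+1 + 1) = 12 * n + 6)%N by lia.
have -> : (2 * (2 * (3 * n).+2 + 1) = 12 * n + 10)%N by lia.
have -> : (6 * (2 * n + 1) = 12 * n + 6)%N by lia.
by ring.
Qed.

(** Since [C(q^4)] inverts the two Euler products, only [1 / ((q; q^6) (q^5; q^6))] will be left of
    the theta series. *)
Lemma theta_euler t B : (2 * t + 2 <= B)%N ->
  eqm t ((theta_poly B + theta_poly B) * prod15 B)
        (2%:R * (euler 4 (3 * B) * euler 12 (3 * B))).
Proof.
case: B => [|B] leB; first by lia.
have le_tB : (t <= B.+1)%N by lia.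
have j1 := @jacobi_trunc 1 1 1 isT isT (mulr1 1) t _ le_tB.
have j3 := @jacobi_trunc 3 2 1 isT isT (mulr1 1) t _ le_tB.
apply: eqm_trans (eqmM (theta_JTP leB) (@eqm_refl _ _)) _.
apply: eqm_trans (eqmM (eqmM (eqm_sym j1) (eqm_sym j3)) (@eqm_refl _ _)) _.
have -> : \prod_(m < B.+1) ((1 - 'X^(2 * 1 * m.+1) : {poly int})
      * (1 + 1 *: 'X^(2 * 1 * m + 1 + 1)) * (1 + 1 *: 'X^(2 * 1 * m + 1 - 1)))
    = euler 4 B.+1 * (2%:R * eulerp 2 B).
  rewrite !big_split /= -(euler_eulerp 2).
  (* The factor at [m = 0] is the constant 2, which matches the doubled theta series; [B] factors
     remain for [eulerp]. *)
  have -> : \prod_(m < B.+1) (1 + 1 *: 'X^(2 * 1 * m + 1 - 1) : {poly int})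
      = 2%:R * eulerp 2 B.
    rewrite big_ord_recl /= scale1r expr0 -[2%:R]/(1 + 1); congr (_ * _).
    by apply: eq_bigr => m _; rewrite scale1r /bump /=; congr (1 + 'X^_); lia.
  congr (_ * _ * _); apply: eq_bigr => m _ //.
  by rewrite scale1r; congr (1 + 'X^_); lia.
rewrite -mulrA.
(* [prod15] turns [1 + x] into [1 - x^2] for [x = q^(6m+1)] and [x = q^(6m+5)]. *)
have -> : \prod_(m < B.+1) ((1 - 'X^(2 * 3 * m.+1) : {poly int})
      * (1 + 1 *: 'X^(2 * 3 * m + 3 + 2)) * (1 + 1 *: 'X^(2 * 3 * m + 3 - 2)))
      * prod15 B.+1 = euler 6 B.+1 * prod210 B.+1.
  rewrite -!big_split; apply: eq_bigr => m _ /=; rewrite !scale1r.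
  have -> : (2 * 3 * m + 3 + 2 = 6 * m + 5)%N by lia.
  have -> : (2 * 3 * m + 3 - 2 = 6 * m + 1)%N by lia.
  have -> : (12 * m + 2 = (6 * m + 1) + (6 * m + 1))%N by lia.
  have -> : (12 * m + 10 = (6 * m + 5) + (6 * m + 5))%N by lia.
  by rewrite !exprD; ring.
have trunc6 : eqm t (euler 6 B.+1) (oddprod 6 B.+1 * euler 12 B.+1).
  by rewrite -euler_odd; apply: euler_trunc; lia.
have truncp : eqm t (eulerp 2 B) (eulerp 2 (2 * (3 * B.+1))).
  by apply: eulerp_trunc; lia.
apply: eqm_trans (eqmM (eqmMl _ (eqmMl _ truncp)) (eqmM trunc6 (@eqm_refl _ _))) _.
have -> : euler 4 B.+1 * (2%:R * eulerp 2 (2 * (3 * B.+1)))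
      * (oddprod 6 B.+1 * euler 12 B.+1 * prod210 B.+1)
    = 2%:R * (euler 4 B.+1 * euler 12 B.+1)
      * (oddprod 2 (3 * B.+1) * eulerp 2 (2 * (3 * B.+1))).
  by rewrite -prod210_odd; ring.
have op : eqm t (oddprod 2 (3 * B.+1) * eulerp 2 (2 * (3 * B.+1))) 1.
  by apply: oddprod_eulerp => //; lia.
apply: eqm_trans (eqmMl _ op) _; rewrite mulr1.
by apply: eqmMl; apply: eqmM; apply: euler_trunc; lia.
Qed.

Theorem theorem1p3 (n : nat) : c n = d n.
Proof.
(* With towers of length [3 * L] and parts up to [12 * L], [prod_c_factor] contains the very factor
   [euler 4 (3 * L)] that [tower_graded_poly] splits off. *)
pose t := n.+1; pose L := t.+2; pose B := (3 * L + 10)%N.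
have ltn : (n < t)%N by [].
have eD : eqm t (tower_poly t (3 * L) Ch * euler 4 (3 * L)) (wlim_poly t * theta_poly B).
  apply: eqm_trans (@tower_graded_poly t _ _) _.
  by apply: graded_wlim_poly; rewrite /B /L; lia.
have eC := @cpart_poly_prod t (12 * L); rewrite prod_c_factor in eC.
have e15 : eqm t (prod15 B) (prod15 (2 * L)).
  apply: (@eqm_prod_trunc _ (fun m => (1 - 'X^(6 * m + 1)) * (1 - 'X^(6 * m + 5))) t).
  - move=> m le_m; rewrite -[X in eqm _ _ X]mulr1 -!scaleN1r.
    by apply: eqmM; apply: eqm_1X; lia.
  - by rewrite /B /L; lia.
  - by rewrite /L; lia.
have eS : eqm t (wlim_poly t * (euler 4 (3 * B) * euler 12 (3 * B))) 1.
  apply: eqm_trans (eqmMl _ (eqm_sym (@pent_euler t B _))) _; first by rewrite /B /L; lia.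
  by apply: wlim_pent_poly; rewrite /B /L; lia.
have eTh := @theta_euler t B; rewrite /B /L in eTh.
have {}eTh := eTh ltac:(lia); rewrite -/L -/B in eTh.
pose u := euler 4 (3 * L) * prod15 (2 * L).
have eDu : eqm t (2%:R * (tower_poly t (3 * L) Ch * u)) 2%:R.
  have -> : 2%:R * (tower_poly t (3 * L) Ch * u)
      = 2%:R * prod15 (2 * L) * (tower_poly t (3 * L) Ch * euler 4 (3 * L)).
    by rewrite /u; ring.
  apply: eqm_trans (eqmMl _ eD) _.
  apply: eqm_trans (eqmM (eqmMl _ (eqm_sym e15)) (@eqm_refl _ _)) _.
  have -> : 2%:R * prod15 B * (wlim_poly t * theta_poly B)
      = wlim_poly t * ((theta_poly B + theta_poly B) * prod15 B) by ring.
  apply: eqm_trans (eqmMl _ eTh) _.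
  rewrite mulrCA -[X in eqm _ _ X]mulr1.
  exact: eqmMl eS.
have eDu1 : eqm t (tower_poly t (3 * L) Ch * u) 1.
  move=> e lt; have := eDu e lt.
  rewrite mulr_natl !coefMn.
  by move/eqP; rewrite eqr_pMn2r // => /eqP.
have u0 : u`_0 = 1.
  rewrite /u coef0M euler0 // mul1r.
  apply: (@prod_coef0 (fun m => (1 - 'X^(6 * m + 1)) * (1 - 'X^(6 * m + 5)))) => m.
  by rewrite coef0M !coef0_1subX // ?mulr1; lia.
(* Both polynomials are inverse to [u] modulo [X^t]. *)
have eCD : eqm t (cpart_poly t (12 * L)) (tower_poly t (3 * L) Ch).
  apply: (eqm_cancel u0); rewrite mulrC; apply: eqm_trans eC _.
  by rewrite mulrC; apply: eqm_sym.
have := eCD n ltn; rewrite !coef_natpoly // => -[].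
rewrite -(@c_cpart_count (12 * L)) ?(@d_towers (3 * L)) /L; try lia.
(* [Ch] has residue 0, so [tower_count] starts from [ground]. *)
by move=> ->; rewrite /tower_count muln0.
Qed.
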